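(* Let $G$ be a distance-regular graph of even order with valency $k$ and diameter $D\geq 3$. If $\lambda\geq 1$ and $3\leq \mu \leq k/2$, then $G$ is $t$-extendable, where $t=\left\lceil \frac{(k-3)(k-1)}{3k-6} \right\rceil$.
   Context: All graphs are finite, simple and undirected. A connected graph $G$ of diameter $D$ is distance-regular if there are integers $b_0,\dots,b_{D-1},c_1,\dots,c_D$ such that for all vertices $x,y$ at distance $i$, the vertex $y$ has exactly $c_i$ neighbors at distance $i-1$ from $x$ (for $1\le i\le D$) and exactly $b_i$ neighbors at distance $i+1$ from $x$ (for $0\le i\le D-1$). Such a graph is regular of valency $k=b_0$. $\lambda$ is the number of common neighbors of any two adjacent vertices, and $\mu=c_2$ is the number of common neighbors of any two vertices at distance $2$. A matching is a set of edges no two of which share a vertex; it is perfect if every vertex is incident with one of its edges. A connected graph of even order $v$ is called $t$-extendable if it contains a perfect matching, $t<v/2$, and every matching of $t$ edges is contained in some perfect matching. *)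

(* Defs.v *)
From mathcomp Require Import all_boot all_order all_algebra.

Set Implicit Arguments.
Unset Strict Implicit.
Unset Printing Implicit Defensive.

(* A finite simple undirected graph is a symmetric irreflexive relation [e] on
   a finType [T]. *)
Section Graphs.
Variables (T : finType) (e : rel T).

Definition connected_graph : Prop := forall x y : T, connect e x y.

Definition walk_of_length (x y : T) (n : nat) : bool :=
  [exists p : n.-tuple T, path e x p && (last x p == y)].

(* Least length of a walk from [x] to [y]. A shortest walk has length less than
   #|T|; the value is #|T| when [y] is not reachable from [x]. *)
Definition gdist (x y : T) : nat := find (walk_of_length x y) (iota 0 #|T|).

Definition diameter : nat := \max_(p : T * T) gdist p.1 p.2.

Definition has_intersection_numbers (b c : nat -> nat) : Prop :=
  forall (i : nat) (x y : T), gdist x y = i ->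
    (1 <= i <= diameter -> #|[set z | e y z & gdist x z == i.-1]| = c i) /\
    (i < diameter -> #|[set z | e y z & gdist x z == i.+1]| = b i).

Definition distance_regular : Prop :=
  connected_graph /\ exists b c : nat -> nat, has_intersection_numbers b c.

Definition regular_of_valency (k : nat) : Prop :=
  forall x : T, #|[set z | e x z]| = k.

Definition common_neighbors (x y : T) : {set T} := [set z | e x z & e y z].

Definition edge_set : {set {set T}} :=
  [set [set p.1; p.2] | p : T * T & e p.1 p.2].

Definition matching (M : {set {set T}}) : bool :=
  (M \subset edge_set) && trivIset M.

Definition perfect_matching (M : {set {set T}}) : bool :=
  matching M && (cover M == [set: T]).

Definition extendable (t : nat) : Prop :=
  [/\ connected_graph, ~~ odd #|T|,
      exists M, perfect_matching M,
      t < #|T|./2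
    & forall M, matching M -> #|M| = t ->
        exists2 N, perfect_matching N & M \subset N].

End Graphs.

(* Main.v *)
Require Import Defs.
From mathcomp Require Import all_boot all_order all_algebra.
From mathcomp Require Import zify ring lra.
Import Order.TTheory GRing.Theory Num.Theory.

Set Implicit Arguments.
Unset Strict Implicit.
Unset Printing Implicit Defensive.

(** Write t for the number of edges of the matching M to be extended; the
    ceiling in the theorem is at most k/3 ([ceil_bound]), and every matching
    with 3t <= k extends ([matching_extends]), the empty one included.

    If M does not extend, Tutte's theorem applied outside M, together with
    parity, gives a set S that contains the vertices of M and q >= s - 2t + 2
    pairwise non-adjacent odd sets outside S, where s = |S|; each of them sends
    edges to S only.  At most ks - 2t edges leave S, because the endpoints of M
    lose one each.  The contradiction ([no_deficient_barrier]) comes from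
    counting these edges.

    A set with at least three vertices inside and outside has at least 3k - 6
    outgoing edges ([edge_cut_ge]), so if a of the odd sets are singletons the
    edge count gives s - a <= k - 3.  If a > 0, then s >= 2a, because the local
    graphs are lambda-regular with lambda >= 1 and the singletons next to a
    vertex are independent ([deg1_le]); and counting the pairs of singletons
    with a common neighbour, at most mu <= k/2 for each pair, forces a > k by
    the Cauchy-Schwarz inequality.  These two bounds are incompatible with
    s - a <= k - 3.

    If a = 0, all q sets are large, and the contradiction is a matter of
    expansion.  The tool, used for [edge_cut_ge] as well, is a flow: let every
    vertex y other than x absorb one unit sent from x along the geodesics from
    x to y, equally divided.  By distance-regularity the amount that enters a
    vertex, or runs along an edge, depends only on the distance from x and
    decreases with it.  Everything that the complement of a set A containing x
    absorbs must cross the boundary of A; this bounds |V \ A| by the number of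
    boundary edges ([edge_flow]) or boundary vertices ([vertex_flow]), those
    next to x counting most.  Choosing x in A with fewest neighbours outside
    makes that contribution small.  For the sets at hand the inequalities, one
    for each set, are added, and the sum contradicts s <= q + 2t - 2
    ([average_flow_absurd]).

    Both applications need k_2 = k b_1 / mu not to be too small compared with
    the number v of vertices.  If D >= 4 then b_1 >= 3 mu / 2
    ([b1_ge_three_halves]), and if D = 3 then v is bounded in terms of k and
    k_2.  The flow settles [edge_cut_ge] except for finitely many parameters
    (k, b_1, mu), which are treated one by one. *)

(** * Hall's theorem *)

Section Hall.
Variables (I T : finType) (x0 : T).

Definition nbhd (A : I -> {set T}) (X : {set I}) : {set T} :=
  \bigcup_(i in X) A i.

(** If some non-empty proper subfamily X is tight, that is, has only |X|
    neighbours, then X and its complement, with the neighbours of X deleted,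
    both satisfy the condition.  If none is tight, every proper subfamily has a
    neighbour to spare and any choice for one index can be completed. *)
Lemma hall (A : I -> {set T}) (J : {set I}) :
  (forall X : {set I}, X \subset J -> #|X| <= #|nbhd A X|) ->
  exists h : I -> T, {in J &, injective h} /\ {in J, forall i, h i \in A i}.
Proof.
elim: {J}#|J| {-2}J (leqnn #|J|) A => [|n IHn] J leJn A hallA.
  have J0 : J = set0 by apply/eqP; rewrite -cards_eq0 -leqn0.
  by exists (fun=> x0); split=> [i j|i]; rewrite J0 inE.
have [J0|[i Ji]] := set_0Vmem J.
  by exists (fun=> x0); split=> [i j|i]; rewrite J0 inE.
case: (boolP [exists X : {set I},
    [&& X \proper J, X != set0 & #|nbhd A X| <= #|X|]]).
  case/existsP=> X /and3P[ltXJ nX0 tightX].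
  have sXJ := proper_sub ltXJ.
  have X_gt0 : 0 < #|X| by rewrite card_gt0.
  have cX : #|X| <= n by have := proper_card ltXJ; lia.
  have cJX : #|J :\: X| <= n by have := cardsDS sXJ; lia.
  have [Y sYX|h1 [inj1 in1]] := IHn X cX A.
    by apply: hallA; apply: subset_trans sYX sXJ.
  have [Y sYJ|h2 [inj2 in2]] := IHn _ cJX (fun j => A j :\: nbhd A X).
    have -> : nbhd (fun j => A j :\: nbhd A X) Y = nbhd A (X :|: Y) :\: nbhd A X.
      apply/setP=> x; rewrite inE; apply/bigcupP/andP.
        case=> j Yj; rewrite inE => /andP[-> Ajx]; split=> //.
        by apply/bigcupP; exists j; rewrite // inE Yj orbT.
      case=> nXx /bigcupP[j]; rewrite inE => /orP[Xj|Yj] Ajx.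
        by case/negP: nXx; apply/bigcupP; exists j.
      by exists j; rewrite // inE nXx.
    have dXY : [disjoint X & Y].
      rewrite disjoint_sym disjoint_subset; apply/subsetP=> j /(subsetP sYJ).
      by rewrite !inE => /andP[].
    have sXYJ : X :|: Y \subset J.
      by rewrite subUset sXJ (subset_trans sYJ) // subsetDl.
    have := hallA _ sXYJ; rewrite cardsU (disjoint_setI0 dXY) cards0.
    have sub : nbhd A X \subset nbhd A (X :|: Y).
      apply/subsetP=> x /bigcupP[j Xj Ajx]; apply/bigcupP; exists j => //.
      by rewrite inE Xj.
    by have := cardsDS sub; have := subset_leq_card sub; lia.
  have in1' j : j \in X -> h1 j \in nbhd A X.
    by move=> Xj; apply/bigcupP; exists j => //; apply: in1.
  have in2' j : j \in J -> j \notin X -> h2 j \in A j :\: nbhd A X.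
    by move=> Jj nXj; apply: in2; rewrite inE nXj.
  exists (fun j => if j \in X then h1 j else h2 j); split=> [j k Jj Jk|j Jj] /=.
    have [Xj|nXj] := boolP (j \in X); have [Xk|nXk] := boolP (k \in X).
    - exact: inj1.
    - move=> eqh; have := in2' _ Jk nXk; rewrite -eqh inE.
      by rewrite (in1' _ Xj).
    - move=> eqh; have := in2' _ Jj nXj; rewrite eqh inE.
      by rewrite (in1' _ Xk).
    - by apply: inj2; rewrite inE ?nXj ?nXk.
  have [Xj|nXj] := boolP (j \in X); first exact: in1.
  by have := in2' _ Jj nXj; rewrite inE => /andP[].
rewrite negb_exists => /forallP notight.
have [x Ax] : exists x, x \in A i.
  have := hallA [set i]; rewrite sub1set cards1 => /(_ Ji).
  rewrite /nbhd big_set1 => A_gt0; apply/set0Pn; rewrite -card_gt0; lia.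
have cJi : #|J :\ i| <= n by have := cardsD1 i J; rewrite Ji; lia.
have [Y sYJ|h [injh inh]] := IHn _ cJi (fun j => A j :\ x).
  have [->|nY0] := eqVneq Y set0; first by rewrite cards0.
  have ltYJ : Y \proper J.
    apply: sub_proper_trans sYJ _; rewrite properE subsetDl.
    by apply/subsetPn; exists i; rewrite // !inE eqxx.
  have := notight Y; rewrite ltYJ nY0 /= -ltnNge => ltY.
  have -> : nbhd (fun j => A j :\ x) Y = nbhd A Y :\ x.
    apply/setP=> y; rewrite inE; apply/bigcupP/andP.
      case=> j Yj; rewrite !inE => /andP[-> Ajy]; split=> //.
      by apply/bigcupP; exists j.
    by case=> yx /bigcupP[j Yj Ajy]; exists j; rewrite // inE yx.
  by have := cardsD1 x (nbhd A Y); lia.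
exists (fun j => if j == i then x else h j); split=> [j k Jj Jk|j Jj] /=.
  have [->|ji] := eqVneq j i; have [->|ki] := eqVneq k i => //.
  - by move=> eqx; have := inh k; rewrite -eqx !inE eqxx ki Jk => /(_ isT).
  - by move=> eqx; have := inh j; rewrite eqx !inE eqxx ji Jj => /(_ isT).
  - by apply: injh; rewrite !inE ?ji ?ki.
have [->//|ji] := eqVneq j i.
by have := inh j; rewrite !inE ji Jj => /(_ isT) /andP[].
Qed.

End Hall.

(** * Tutte's theorem *)

Section Tutte.
Variables (T : finType) (e : rel T).
Hypothesis e_sym : symmetric e.
Implicit Types (U S W C : {set T}) (P : {set {set T}}) (x y : T).

Definition has_matching_on (U : {set T}) :=
  exists2 M, matching e M & cover M = U.

Lemma matching_bigcup (I : finType) (J : {set I}) (M : I -> {set {set T}})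
    (B : I -> {set T}) :
    (forall i, i \in J -> matching e (M i) /\ cover (M i) = B i) ->
    (forall i j, i \in J -> j \in J -> i != j -> [disjoint B i & B j]) ->
  has_matching_on (\bigcup_(i in J) B i).
Proof.
move=> matM disjB; exists (\bigcup_(i in J) M i).
  apply/andP; split.
    by apply/bigcupsP=> i /matM[/andP[]].
  apply/trivIsetP=> X Y /bigcupP[i Ji Xi] /bigcupP[j Jj Yj] neqXY.
  have [/andP[_ trivi] coveri] := matM _ Ji.
  have [_ coverj] := matM _ Jj.
  have [eqij|neqij] := eqVneq i j.
    by apply: (trivIsetP trivi) => //; rewrite eqij.
  apply: disjointWl (disjointWr _ (disjB _ _ Ji Jj neqij)).
    by rewrite -coveri; apply: bigcup_sup.
  by rewrite -coverj; apply: bigcup_sup.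
apply/setP=> x; apply/bigcupP/bigcupP.
  case=> X /bigcupP[i Ji Xi] Xx; exists i => //.
  by have [_ <-] := matM _ Ji; apply/bigcupP; exists X.
case=> i Ji; have [_ <-] := matM _ Ji => /bigcupP[X Xi Xx].
by exists X => //; apply/bigcupP; exists i.
Qed.

Lemma matching1 x y : e x y -> matching e [set [set x; y]] /\
  cover [set [set x; y]] = [set x; y].
Proof.
move=> exy; rewrite /cover big_set1; split=> //; apply/andP; split.
  by rewrite sub1set; apply/imsetP; exists (x, y); rewrite ?inE.
by apply/trivIsetP=> X Y; rewrite !inE => /eqP-> /eqP->; rewrite eqxx.
Qed.

Lemma matchingU M N : matching e M -> matching e N ->
  [disjoint cover M & cover N] ->
  matching e (M :|: N) /\ cover (M :|: N) = cover M :|: cover N.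
Proof.
case/andP=> sM tM /andP[sN tN] dMN; split.
  by rewrite /matching subUset sM sN /= trivIsetU.
by rewrite /cover bigcup_setU.
Qed.

Definition closed_in (W C : {set T}) :=
  [forall x in C, forall y in W, e x y ==> (y \in C)].

Lemma closed_inP (W C : {set T}) :
  reflect (forall x y, x \in C -> y \in W -> e x y -> y \in C) (closed_in W C).
Proof.
apply: (iffP 'forall_in_forall_inP) => H x.
  by move=> y Cx Wy; apply/implyP; apply: H.
by move=> Cx y Wy; apply/implyP; apply: H.
Qed.

(** An odd closed subset stands for an odd component of the graph induced on W:
    it contains one, and the counts below use only its parity and the fact that
    no edge of W leaves it. *)
Definition odd_closed (W C : {set T}) :=
  [&& C \subset W, odd #|C| & closed_in W C].

Definition barrier (U S : {set T}) (P : {set {set T}}) :=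
  [&& S \subset U, trivIset P & [forall C in P, odd_closed (U :\: S) C]].

Lemma barrierP U S P : reflect
  [/\ S \subset U, trivIset P & forall C, C \in P -> odd_closed (U :\: S) C]
  (barrier U S P).
Proof.
by apply: (iffP and3P) => [[? ? /forall_inP]|[? ? ?]]; split=> //; apply/forall_inP.
Qed.

Lemma barrier_cover U S P : barrier U S P -> cover P \subset U :\: S.
Proof. by case/barrierP=> _ _ ocP; apply/bigcupsP=> C /ocP/and3P[]. Qed.

Lemma odd_closedX W C : odd_closed W C -> exists x, x \in C.
Proof.
case/and3P=> _ oddC _; apply/set0Pn; apply: contraTneq oddC => ->.
by rewrite cards0.
Qed.

(** The members are disjoint and odd, so parity counts them. *)
Lemma odd_cover U S P : barrier U S P -> odd #|cover P| = odd #|P|.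
Proof.
case/barrierP=> _ tP ocP; rewrite -(eqP tP).
rewrite -sum1_card !(big_morph odd oddD (erefl (odd 0))).
by apply: eq_bigr => C /ocP/and3P[_ -> _].
Qed.

Lemma odd_closed_rest U S P : barrier U S P ->
  closed_in (U :\: S) ((U :\: S) :\: cover P).
Proof.
case/barrierP=> _ _ ocP; apply/closed_inP=> x y.
rewrite !inE => /andP[nPx /andP[nSx Ux]] /andP[nSy Uy] exy.
rewrite nSy Uy !andbT; apply: contra nPx => /bigcupP[C PC Cy].
have /and3P[_ _ /closed_inP clC] := ocP C PC.
by apply/bigcupP; exists C => //; apply: clC Cy _ _; rewrite ?inE ?nSx // e_sym.
Qed.

Lemma barrierU1 U S P C : barrier U S P -> odd_closed (U :\: S) C ->
  [disjoint C & cover P] ->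
  barrier U S (C |: P) /\ #|C |: P| = #|P|.+1.
Proof.
move=> barP ocC dCP; have [SU tP ocP] := barrierP _ _ _ barP.
have [x Cx] := odd_closedX ocC.
have CnP : C \notin P.
  apply: contraL dCP => PC; apply/pred0Pn; exists x.
  by rewrite /= Cx; apply/bigcupP; exists C.
split; last by rewrite cardsU1 CnP.
apply/barrierP; split=> //; last by move=> B /setU1P[->|/ocP].
apply/trivIsetP=> X Y; rewrite !inE.
have distC Y0 : Y0 \in P -> [disjoint C & Y0].
  by move=> PY; apply: disjointWr dCP; apply: bigcup_sup.
case/orP=> [/eqP->|PX] /orP[/eqP->|PY].
- by rewrite eqxx.
- by move=> _; apply: distC.
- by move=> _; rewrite disjoint_sym; apply: distC.
- by move/trivIsetP: tP; apply.
Qed.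

(** What the members leave over in U \ S is itself closed.  If U is even and
    there is exactly one member more than |S|, the leftover is odd and becomes a
    further member. *)
Lemma barrier_parity U S P : ~~ odd #|U| -> barrier U S P -> #|S| < #|P| ->
  exists2 P' : {set {set T}}, barrier U S P' & #|S|.+2 <= #|P'|.
Proof.
move=> evenU barP ltSP; have [SU _ _] := barrierP _ _ _ barP.
have [leSP|gtSP] := leqP #|S|.+2 #|P|; first by exists P.
have eqP1 : #|P| = #|S|.+1 by lia.
set R := (U :\: S) :\: cover P.
have cR : #|R| = #|U| - #|S| - #|cover P|.
  by rewrite /R cardsDS ?barrier_cover // cardsDS.
have oddR : odd #|R|.
  have := subset_leq_card (barrier_cover barP); rewrite cardsDS // => leP.
  have := odd_cover barP; rewrite eqP1 cR.
  have := subset_leq_card SU => leS.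
  rewrite oddB // oddB //= (negPf evenU) /= => ->.
  by case: (odd _).
have ocR : odd_closed (U :\: S) R.
  by rewrite /odd_closed oddR odd_closed_rest ?subsetDl.
have dR : [disjoint R & cover P].
  by rewrite disjoints_subset; apply/subsetP=> x; rewrite !inE => /andP[].
have [barP' cP'] := barrierU1 barP ocR dR.
by exists (R |: P); rewrite ?cP' ?eqP1.
Qed.

Lemma set0_matching : matching e set0 /\ cover (@set0 {set T}) = set0.
Proof.
rewrite /cover big_set0; split=> //; rewrite /matching sub0set /=.
by apply/trivIsetP=> X Y; rewrite inE.
Qed.

Lemma barrier_set0 U : barrier U set0 set0.
Proof.
apply/barrierP; split; first exact: sub0set.
  by have [/andP[]] := set0_matching.
by move=> C; rewrite inE.
Qed.

(** A member C can be opened up: the point c and a barrier set of C \ c move to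
    S, and the members inside C \ c replace C. *)
Lemma barrier_refine U S P C c S1 P1 : barrier U S P -> C \in P -> c \in C ->
  barrier (C :\ c) S1 P1 ->
  barrier U (c |: (S :|: S1)) (P1 :|: P :\ C) /\
  (#|c |: (S :|: S1)| = #|S| + #|S1| + 1 /\
   #|P1 :|: P :\ C| = #|P1| + #|P| - 1).
Proof.
move=> barP PC Cc bar1.
have [SU tP ocP] := barrierP _ _ _ barP.
have [S1C tP1 ocP1] := barrierP _ _ _ bar1.
have /and3P[CW oddC /closed_inP clC] := ocP _ PC.
have sub1 x : x \in C :\ c -> [/\ x != c, x \in C, x \notin S & x \in U].
  by rewrite !inE => /andP[-> Cx]; have := subsetP CW _ Cx; rewrite inE => /andP[-> ->].
have sP1 x : x \in cover P1 -> x \in C :\ c.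
  by move/(subsetP (barrier_cover bar1)); rewrite inE => /andP[].
have [nSc Uc] : c \notin S /\ c \in U.
  by have := subsetP CW _ Cc; rewrite inE => /andP[-> ->].
have notC Y x : Y \in P :\ C -> x \in Y -> x \notin C.
  rewrite !inE => /andP[neqYC PY] Yx; apply: contra neqYC => Cx.
  move/trivIsetP: tP => /(_ _ _ PY PC); case: eqVneq => // _ /(_ isT) dis.
  by have := disjointFr dis Yx; rewrite Cx.
have dP : [disjoint cover P1 & cover (P :\ C)].
  rewrite disjoint_subset; apply/subsetP=> x /sP1/sub1[_ Cx _ _].
  by rewrite inE; apply/bigcupP=> -[Y PY] Yx; have := notC _ _ PY Yx; rewrite Cx.
have dPP : P1 :&: (P :\ C) = set0.
  apply/setP=> Y; rewrite [RHS]inE; apply/setIP=> -[P1Y PY].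
  have [x Yx] := odd_closedX (ocP1 _ P1Y).
  have /sP1/sub1[_ Cx _ _] : x \in cover P1 by apply/bigcupP; exists Y.
  by have := notC _ _ PY Yx; rewrite Cx.
split; last first.
  rewrite (cardsU P1) dPP cards0 subn0 cardsU1 cardsU.
  have -> : S :&: S1 = set0.
    apply/setP=> x; rewrite [RHS]inE; apply/setIP=> -[Sx /(subsetP S1C)/sub1[_ _]].
    by rewrite Sx.
  have -> : c \notin S :|: S1.
    rewrite inE (negPf nSc) /=; apply/negP=> /(subsetP S1C)/sub1[].
    by rewrite eqxx.
  rewrite cards0 (cardsD1 C P) PC subn0 /= !add1n !addnS !addn0 subn1 /=; by split.
apply/barrierP; split.
- rewrite subUset sub1set Uc subUset SU /=; apply/subsetP=> x.
  by move/(subsetP S1C)/sub1=> [].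
- apply: trivIsetU => //; apply: trivIsetS tP; exact: subsetDl.
move=> Y /setUP[P1Y|PY].
  have /and3P[YW1 oddY /closed_inP clY] := ocP1 _ P1Y.
  rewrite /odd_closed oddY /=; apply/andP; split.
    apply/subsetP=> x Yx; have /setDP[/sub1[xc _ nSx Ux] nS1x] := subsetP YW1 _ Yx.
    by rewrite !inE negb_or xc negb_or nSx nS1x.
  apply/closed_inP=> x y Yx; rewrite !inE !negb_or => /andP[/and3P[yc nSy nS1y] Uy] exy.
  apply: (clY x) => //; rewrite !inE nS1y yc /=; apply: (clC x) => //.
    by have /setDP[/sub1[]] := subsetP YW1 _ Yx.
  by rewrite inE nSy.
have /and3P[YW oddY /closed_inP clY] : odd_closed (U :\: S) Y.
  by apply: ocP; move: PY; rewrite inE => /andP[].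
rewrite /odd_closed oddY /=; apply/andP; split.
  apply/subsetP=> x Yx; have := subsetP YW _ Yx; rewrite !inE !negb_or => /andP[-> ->].
  rewrite /= !andbT; have nCx := notC _ _ PY Yx.
  apply/andP; split; apply: contra nCx; first by move/eqP->.
  by case/(subsetP S1C)/sub1.
apply/closed_inP=> x y Yx; rewrite !inE !negb_or => /andP[/and3P[yc nSy nS1y] Uy] exy.
by apply: (clY x) => //; rewrite inE nSy.
Qed.

(** Induction on |U|.  If U is even and no barrier is deficient, take a barrier
    with as many members as points and S as large as possible.  Maximality has
    two consequences: the members exhaust U \ S, since a leftover point could
    move to S and make the rest of the leftover odd; and every member minus any
    of its points has a perfect matching, since otherwise [barrier_refine] would
    give a larger S.  Hall's condition between the members and S is the absence
    of deficient barriers, so every member can be joined to its own point of S,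
    and this uses up S. *)
Theorem tutte U : has_matching_on U \/
  exists S P, barrier U S P /\ #|S| < #|P|.
Proof.
elim: {U}#|U|.+1 {-2}U (ltnSn #|U|) => // n IHn U; rewrite ltnS => leUn.
have [oddU|evenU] := boolP (odd #|U|).
  right; exists set0, [set U]; rewrite cards0 cards1; split=> //.
  apply/barrierP; split; first exact: sub0set.
    by apply/trivIsetP=> X Y; rewrite !inE => /eqP-> /eqP->; rewrite eqxx.
  move=> C /set1P->; rewrite /odd_closed setD0 subxx oddU /=.
  by apply/closed_inP.
have [/existsP[[S P] /andP[barP ltSP]]|nobar] :=
    boolP [exists SP : {set T} * {set {set T}},
      barrier U SP.1 SP.2 && (#|SP.1| < #|SP.2|)].
  by right; exists S, P.
have {}nobar S P : barrier U S P -> #|P| <= #|S|.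
  move=> barP; rewrite leqNgt; apply: contra nobar => ltSP.
  by apply/existsP; exists (S, P); rewrite barP.
left.
pose tight (SP : {set T} * {set {set T}}) := barrier U SP.1 SP.2 && (#|SP.2| == #|SP.1|).
have tight0 : tight (set0, set0) by rewrite /tight barrier_set0 /= !cards0.
case: (arg_maxnP (fun SP : {set T} * {set {set T}} => #|SP.1|) tight0).
move=> [S P] /andP[/= barP /eqP eqPS] maxS.
have {}maxS S' P' : barrier U S' P' -> #|S| < #|S'| -> #|P'| < #|S'|.
  move=> bar' ltS; rewrite ltn_neqAle nobar // andbT.
  apply: contraL ltS => eqP'; rewrite -leqNgt.
  by apply: (maxS (S', P')); rewrite /tight /= bar'.
have [SU tP ocP] := barrierP _ _ _ barP.
(* a leftover point c could move to S, the odd rest of the leftover becoming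
   a member *)
have coverE : cover P = U :\: S.
  apply/eqP; rewrite eqEsubset barrier_cover //=; apply/negP=> /negP.
  rewrite -setD_eq0 => /set0Pn[c Rc].
  set R := _ :\: cover P in Rc.
  have [nPc nSc Uc] : [/\ c \notin cover P, c \notin S & c \in U].
    by move: Rc; rewrite !inE => /and3P[].
  have clR := odd_closed_rest barP.
  have bar' : barrier U (c |: S) P.
    apply/barrierP; split=> //; first by rewrite subUset sub1set Uc.
    move=> C PC; have /and3P[CW oddC /closed_inP clC] := ocP _ PC.
    rewrite /odd_closed oddC /=; apply/andP; split.
      apply/subsetP=> x Cx; have := subsetP CW _ Cx; rewrite !inE negb_or.
      case/andP=> -> ->; rewrite !andbT; apply: contra nPc => /eqP<-.
      by apply/bigcupP; exists C.
    apply/closed_inP=> x y Cx; rewrite !inE negb_or => /andP[/andP[_ nSy] Uy] exy.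
    by apply: (clC x) => //; rewrite inE nSy.
  have cS' : #|c |: S| = #|S|.+1 by rewrite cardsU1 nSc.
  have oddR : odd #|R :\ c|.
    have cR : #|R| = #|U| - #|S| - #|cover P|.
      by rewrite /R cardsDS ?barrier_cover // cardsDS.
    have := cardsD1 c R; rewrite Rc => cRc.
    have := subset_leq_card (barrier_cover barP); rewrite cardsDS // => leP.
    have := odd_cover barP; rewrite eqPS => oddcP.
    have leS := subset_leq_card SU.
    have : ~~ odd #|R|.
      rewrite cR oddB // oddB // oddcP (negPf evenU) /=.
      by case: (odd _).
    by rewrite cRc /= negbK.
  have ocR : odd_closed (U :\: (c |: S)) (R :\ c).
    rewrite /odd_closed oddR /=; apply/andP; split.
      apply/subsetP=> x; rewrite !inE negb_or.
      by case/and4P=> -> _ -> ->.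
    apply/closed_inP=> x y; rewrite !inE negb_or.
    case/and4P=> _ nPx nSx Ux /andP[/andP[yc nSy] Uy] exy.
    have /closed_inP/(_ x y) := clR.
    by rewrite !inE nPx nSx Ux nSy Uy yc; apply.
  have dR : [disjoint R :\ c & cover P].
    by rewrite disjoints_subset; apply/subsetP=> x; rewrite !inE => /and3P[].
  have [bar2 c2] := barrierU1 bar' ocR dR.
  have := maxS _ _ bar2; rewrite cS' ltnSn => /(_ isT).
  by rewrite c2 eqPS ltnn.
have matC C c : C \in P -> c \in C -> has_matching_on (C :\ c).
  move=> PC Cc; have /and3P[CW oddC _] := ocP _ PC.
  have cC := cardsD1 c C; rewrite Cc in cC.
  have lec : #|C :\ c| < n.
    have := subset_leq_card (subset_trans CW (subsetDl _ _)); lia.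
  have [//|[S1 [P1 [bar1 lt1]]]] := IHn _ lec.
  have even1 : ~~ odd #|C :\ c| by move: oddC; rewrite cC.
  have [P2 bar2 le2] := barrier_parity even1 bar1 lt1.
  have [bar3 [cS3 cP3]] := barrier_refine barP PC Cc bar2.
  have arith (a b d : nat) : b.+2 <= d -> (a < a + b + 1 -> d + a - 1 < a + b + 1) ->
    False by clear; lia.
  have := maxS _ _ bar3; rewrite cS3 cP3 eqPS => max3.
  by case: (arith _ _ _ le2 max3).
have [P0|[C0 PC0]] := set_0Vmem P.
  exists set0; first by case: set0_matching.
  have S0 : S = set0 by apply/eqP; rewrite -cards_eq0 -eqPS P0 cards0.
  by have := coverE; rewrite P0 S0 setD0.
have [x0 _] := odd_closedX (ocP _ PC0).
(* a subfamily X violating Hall's condition is a deficient barrier over its own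
   neighbours in S *)
have halP (X : {set {set T}}) : X \subset P ->
    #|X| <= #|nbhd (fun C => [set u in S | [exists x in C, e x u]]) X|.
  move=> sXP; apply: nobar; apply/barrierP; split.
  - apply/subsetP=> u /bigcupP[C _]; rewrite inE => /andP[Su _].
    exact: (subsetP SU).
  - exact: trivIsetS sXP tP.
  move=> C XC; have PC := subsetP sXP _ XC.
  have /and3P[CW oddC /closed_inP clC] := ocP _ PC.
  rewrite /odd_closed oddC /=; apply/andP; split.
    apply/subsetP=> x Cx; have := subsetP CW _ Cx; rewrite !inE => /andP[nSx ->].
    rewrite andbT; apply: contra nSx => /bigcupP[D _].
    by rewrite inE => /andP[].
  apply/closed_inP=> x y Cx; rewrite inE => /andP[nNy Uy] exy.
  apply: (clC x) => //; rewrite inE Uy andbT; apply: contra nNy => Sy.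
  apply/bigcupP; exists C => //; rewrite inE Sy; apply/existsP; exists x.
  by rewrite Cx.
have [h [injh inh]] := hall x0 halP.
have hS C : C \in P -> h C \in S by move/inh; rewrite inE => /andP[].
pose c C := odflt x0 [pick x in C | e x (h C)].
have cP C : C \in P -> c C \in C /\ e (c C) (h C).
  move=> PC; have := inh _ PC; rewrite inE => /andP[_ /existsP[x /andP[Cx ex]]].
  rewrite /c; case: pickP => [y /andP[] //|/(_ x)]; by rewrite Cx ex.
have hnC C D : C \in P -> D \in P -> h C \notin D.
  move=> PC PD; apply/negP=> Dh; have : h C \in U :\: S.
    by rewrite -coverE; apply/bigcupP; exists D.
  by rewrite inE hS.
have h_onto : h @: P = S.
  apply/eqP; rewrite eqEcard card_in_imset // eqPS leqnn andbT.
  by apply/subsetP=> u /imsetP[C PC ->]; apply: hS.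
have exM C : exists M, C \in P -> matching e M /\ cover M = h C |: C.
  have [PC|_] := boolP (C \in P); last by exists set0.
  have [Cc ech] := cP _ PC; have [M matM covM] := matC _ _ PC Cc.
  have [mat1 cov1] := matching1 ech.
  have [|matU covU] := matchingU mat1 matM.
    rewrite cov1 covM disjoint_subset; apply/subsetP=> x.
    rewrite !inE negb_and negbK; case/orP=> /eqP->; rewrite ?eqxx //.
    by rewrite hnC ?orbT.
  exists ([set [set c C; h C]] :|: M) => _; split=> //; rewrite covU cov1 covM.
  apply/setP=> x; rewrite !inE.
  by have [->|xc] /= := eqVneq x (c C); rewrite ?Cc ?orbT.
have [M matM] := fin_all_exists exM.
have -> : U = \bigcup_(C in P) (h C |: C).
  apply/setP=> x; apply/idP/bigcupP=> [Ux|[C PC]].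
    have [|nSx] := boolP (x \in S).
      by rewrite -h_onto => /imsetP[C PC ->]; exists C; rewrite // setU11.
    have : x \in cover P by rewrite coverE inE nSx.
    by case/bigcupP=> C PC Cx; exists C; rewrite // inE Cx orbT.
  rewrite inE => /orP[/set1P->|Cx]; first by apply: (subsetP SU); apply: hS.
  have : x \in U :\: S by rewrite -coverE; apply/bigcupP; exists C.
  by rewrite inE => /andP[].
apply: (matching_bigcup matM) => C D PC PD neqCD.
rewrite disjoint_subset; apply/subsetP=> x; rewrite !inE negb_or.
case/orP=> [/eqP->|Cx].
  rewrite hnC // andbT; apply: contra neqCD => /eqP eqh.
  by apply/eqP; apply: injh.
move/trivIsetP: tP => /(_ _ _ PC PD neqCD) dCD.
rewrite (disjointFr dCD Cx) andbT; apply/eqP=> eqx.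
by have := hnC D C PD PC; rewrite -eqx Cx.
Qed.

End Tutte.

(** * Distances in a connected graph *)

Section Distance.
Variables (T : finType) (e : rel T).
Hypothesis e_sym : symmetric e.
Hypothesis e_irr : irreflexive e.
Hypothesis e_conn : connected_graph e.
Implicit Types (x y z : T).

Local Notation d := (gdist e).

Lemma walkP x y n :
  reflect (exists p, [/\ path e x p, last x p = y & size p = n])
          (walk_of_length e x y n).
Proof.
apply: (iffP existsP) => [[p /andP[xp /eqP yp]]|[p [xp yp /eqP sp]]].
  by exists p; rewrite size_tuple.
by exists (Tuple sp); rewrite /= xp yp eqxx.
Qed.

Lemma gdist_le_size x p : path e x p -> d x (last x p) <= size p.
Proof.
move=> xp; rewrite /gdist leqNgt; apply/negP=> lt_p.
have lt_pT : size p < #|T|.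
  by apply: leq_trans lt_p _; rewrite -{2}(size_iota 0 #|T|) find_size.
have := before_find 0 lt_p; rewrite nth_iota // add0n => /walkP[].
by exists p.
Qed.

Lemma gdistP x y : exists p, [/\ path e x p, last x p = y & size p = d x y].
Proof.
have /connectP[p0 xp0 ->] := e_conn x y.
have [p xp uniqp _] := shortenP xp0; apply/walkP.
have hasw : has (walk_of_length e x (last x p)) (iota 0 #|T|).
  apply/hasP; exists (size p); last by apply/walkP; exists p.
  rewrite mem_iota /= add0n.
  by have := max_card (mem (x :: p)); rewrite (card_uniqP uniqp).
have := nth_find 0 hasw; rewrite nth_iota ?add0n //.
by move: hasw; rewrite has_find size_iota.
Qed.

Lemma gdistxx x : d x x = 0.
Proof. by apply/eqP; rewrite -leqn0; apply: (@gdist_le_size x [::]). Qed.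

Lemma gdist_eq0 x y : (d x y == 0) = (x == y).
Proof.
apply/eqP/eqP=> [|->]; last exact: gdistxx.
by have [p [_ <- <-]] := gdistP x y; case: p.
Qed.

Lemma gdist_triangle y x z : d x z <= d x y + d y z.
Proof.
have [p [xp yp <-]] := gdistP x y; have [q [yq zq <-]] := gdistP y z.
have -> : z = last x (p ++ q) by rewrite last_cat yp zq.
by rewrite -size_cat gdist_le_size // cat_path xp yp.
Qed.

Lemma gdist_sym x y : d x y = d y x.
Proof.
suff le x1 y1 : d x1 y1 <= d y1 x1 by apply/eqP; rewrite eqn_leq !le.
have [p [yp <- <-]] := gdistP y1 x1.
elim: p y1 yp {x1} => [|z p IHp] y1 /=; first by rewrite gdistxx.
case/andP=> yz /IHp le_p; apply: leq_trans (gdist_triangle z _ _) _.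
rewrite -addn1 leq_add // (@gdist_le_size z [:: y1]) //= andbT.
by rewrite e_sym.
Qed.

Lemma gdist1 x y : (d x y == 1) = e x y.
Proof.
have le1 : e x y -> d x y <= 1.
  by move=> exy; apply: (@gdist_le_size x [:: y]); rewrite /= exy.
apply/eqP/idP=> [|exy].
  have [p [xp yp <-]] := gdistP x y.
  by case: p xp yp => [|z []] //= /andP[exz _] <-.
apply/eqP; rewrite eqn_leq le1 // lt0n gdist_eq0.
by apply: contraTneq exy => ->; rewrite e_irr.
Qed.

Lemma gdist_edge x y z : e y z -> d x z <= (d x y).+1.
Proof.
rewrite -gdist1 => /eqP dyz.
by rewrite -addn1 -dyz gdist_triangle.
Qed.

Lemma gdist_pred x y i : d x y = i.+1 -> exists2 z, e y z & d x z = i.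
Proof.
have [p [xp yp eqp]] := gdistP x y; move: xp yp eqp; case/lastP: p => [|p z].
  by move=> _ _ <-.
rewrite rcons_path last_rcons size_rcons => /andP[xp ez] zy eqp dxy.
move: eqp; rewrite dxy => -[eqi].
have lei : d x (last x p) <= i by rewrite -eqi gdist_le_size.
exists (last x p); first by rewrite e_sym -zy.
have := gdist_edge x ez; rewrite zy dxy ltnS => gei.
by apply/eqP; rewrite eqn_leq lei.
Qed.

Lemma gdist_between x y j : j <= d x y ->
  exists2 z, d x z = j & d z y = d x y - j.
Proof.
move: {2}(d x y - j) (erefl (d x y - j)) => n.
elim: n j => [|n IHn] j eqn lej.
  by exists y; rewrite ?gdistxx //; lia.
have [||z dz dzy] := IHn j.+1; try lia.
have [w ezw dw] := gdist_pred dz; exists w => //.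
have := gdist_triangle w x y; have := gdist_edge y ezw.
by rewrite !(gdist_sym y) dw; lia.
Qed.

Lemma gdist_diameter x y : d x y <= diameter e.
Proof. exact: (leq_bigmax (F := fun p : T * T => d p.1 p.2) (x, y)). Qed.

Lemma diameterP (x0 : T) : exists x y, d x y = diameter e.
Proof.
have [|p eqp] := @bigop.eq_bigmax _ (fun p : T * T => d p.1 p.2).
  by apply/card_gt0P; exists (x0, x0).
by exists p.1, p.2; rewrite -eqp.
Qed.

End Distance.

(** * Intersection numbers *)

Record drg (T : finType) (e : rel T) (k lam mu : nat) (b c : nat -> nat) : Prop :=
  Drg {
    drg_sym : symmetric e;
    drg_irr : irreflexive e;
    drg_conn : connected_graph e;
    drg_num : has_intersection_numbers e b c;
    drg_val : regular_of_valency e k;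
    drg_lam : forall x y, e x y -> #|common_neighbors e x y| = lam;
    drg_mu : forall x y, gdist e x y = 2 -> #|common_neighbors e x y| = mu;
    drg_diam : 3 <= diameter e
  }.

Lemma card_set_sum (T : finType) (A : {pred T}) (P : pred T) :
  #|[set z in A | P z]| = \sum_(z in A) P z.
Proof.
rewrite -sum1_card big_mkcond [RHS]big_mkcond /=; apply: eq_bigr => z _.
by rewrite !inE; case: (z \in A); case: (P z).
Qed.

Section DRG.
Variables (T : finType) (e : rel T) (k lam mu : nat) (b c : nat -> nat).
Hypothesis G : drg e k lam mu b c.
Implicit Types (x y z : T).

Let e_sym := drg_sym G.
Let e_irr := drg_irr G.
Let e_conn := drg_conn G.
Local Notation d := (gdist e).
Local Notation D := (diameter e).
Local Notation N x := [set z | e x z] (only parsing).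

Definition sphere x i : {set T} := [set z | d x z == i].

Lemma distC x y : d x y = d y x. Proof. exact: gdist_sym. Qed.
Lemma dist_step x y z : e y z -> d x z <= (d x y).+1.
Proof. exact: gdist_edge. Qed.
Lemma dist_back x y z : e y z -> d x y <= (d x z).+1.
Proof. by move=> eyz; apply: dist_step; rewrite e_sym. Qed.
Lemma dist1 x y : (d x y == 1) = e x y. Proof. exact: gdist1. Qed.
Lemma adj_dist1 x y : e x y -> d x y = 1. Proof. by rewrite -dist1 => /eqP. Qed.

Lemma c_num x y i : d x y = i.+1 -> #|[set z | e y z & d x z == i]| = c i.+1.
Proof.
move=> dxy; have [<- //] := drg_num G dxy.
by rewrite -{2}dxy gdist_diameter andbT.
Qed.

Lemma b_num x y i : d x y = i -> i < D -> #|[set z | e y z & d x z == i.+1]| = b i.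
Proof. by move=> dxy ltiD; have [_ ->] := drg_num G dxy. Qed.

Lemma drg_point : exists x : T, true.
Proof.
have [x _|T0] := pickP (mem T); first by exists x.
have := drg_diam G; rewrite /diameter big_pred0 // => -[x y].
by have := T0 x; rewrite inE.
Qed.

Lemma pair_at i : i <= D -> exists x y, d x y = i.
Proof.
move=> leiD; have [x0 _] := drg_point.
have [x [y dxy]] := diameterP e x0; rewrite -dxy in leiD.
by have [z dxz _] := gdist_between e_sym e_irr e_conn leiD; exists x, z.
Qed.

Lemma b_gt0 i : i < D -> 0 < b i.
Proof.
move=> ltiD; have [x [y dxy]] := pair_at ltiD.
have [z eyz dxz] := gdist_pred e_sym e_irr e_conn dxy.
rewrite -(b_num dxz ltiD); apply/card_gt0P; exists y.
by rewrite inE e_sym eyz dxy eqxx.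
Qed.

Lemma b_ext x y i : d x y = i -> i < D -> exists2 z, e y z & d x z = i.+1.
Proof.
move=> dxy ltiD; have := b_gt0 ltiD; rewrite -(b_num dxy ltiD).
by case/card_gt0P=> z; rewrite inE => /andP[eyz /eqP]; exists z.
Qed.

Lemma c_gt0 i : i < D -> 0 < c i.+1.
Proof.
move=> ltiD; have [x [y dxy]] := pair_at ltiD.
have [z eyz dxz] := gdist_pred e_sym e_irr e_conn dxy.
rewrite -(c_num dxy); apply/card_gt0P; exists z.
by rewrite inE eyz dxz eqxx.
Qed.

(** Replacing x by its successor on a geodesic from x to y turns a neighbour of
    y that is farther from x into one that is farther from the successor. *)
Lemma b_noninc i : i.+1 < D -> b i.+1 <= b i.
Proof.
move=> ltiD; have [x [y dxy]] := pair_at (ltnW ltiD).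
have dyx : d y x = i.+1 by rewrite distC.
have [w exw dyw] := gdist_pred e_sym e_irr e_conn dyx.
have dwy : d w y = i by rewrite distC.
rewrite -(b_num dxy ltiD) -(b_num dwy (ltnW ltiD)).
apply: subset_leq_card; apply/subsetP=> z; rewrite !inE => /andP[eyz /eqP dxz].
have := dist_step w eyz; have := dist_back z exw.
rewrite dwy !(distC z) dxz eyz ltnS => le1 le2.
by rewrite eqn_leq le1 le2.
Qed.

Lemma c_nondec i : i.+1 < D -> c i.+1 <= c i.+2.
Proof.
move=> ltiD; have [x [y dxy]] := pair_at ltiD.
have dyx : d y x = i.+2 by rewrite distC.
have [w exw dyw] := gdist_pred e_sym e_irr e_conn dyx.
have dwy : d w y = i.+1 by rewrite distC.
rewrite -(c_num dxy) -(c_num dwy).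
apply: subset_leq_card; apply/subsetP=> z; rewrite !inE => /andP[eyz /eqP dwz].
have := dist_back x eyz; have := dist_back z exw.
rewrite dxy !(distC z) dwz eyz => le1 le2.
by rewrite eqn_leq le1 -ltnS le2.
Qed.

(** With y on a geodesic from x to z, a step from y towards z is a step away
    from x. *)
Lemma c_le_b i j : i.+1 + j <= D -> c i.+1 <= b j.
Proof.
move=> leijD; have [x [z dxz]] := pair_at leijD.
have lej : j <= d x z by rewrite dxz leq_addl.
have [y dxy dyz] := gdist_between e_sym e_irr e_conn lej.
have dzy : d z y = i.+1 by rewrite distC dyz dxz addnK.
have ltjD : j < D by apply: leq_trans leijD; rewrite addSn ltnS leq_addl.
rewrite -(b_num dxy ltjD) -(c_num dzy).
apply: subset_leq_card; apply/subsetP=> w; rewrite !inE => /andP[eyw /eqP dzw].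
have := dist_step x eyw; have := gdist_triangle e_conn w x z.
rewrite eyw dxy dxz (distC w) dzw addSnnS addnC leq_add2r => le1 le2.
by rewrite eqn_leq le1 le2.
Qed.

Lemma cardN x : #|N x| = k. Proof. exact: (drg_val G). Qed.

Lemma c1E : c 1 = 1.
Proof.
have [x [y dxy]] := pair_at (leq_trans (isT : 1 <= 3) (drg_diam G)).
rewrite -(c_num dxy) -(cards1 x); apply: eq_card => z; rewrite !inE.
rewrite gdist_eq0 // eq_sym; case: eqVneq => [->|]; rewrite ?andbF // andbT.
by rewrite e_sym -dist1 dxy.
Qed.

Lemma c2E : c 2 = mu.
Proof.
have [x [y dxy]] := pair_at (leq_trans (isT : 2 <= 3) (drg_diam G)).
rewrite -(c_num dxy) -(drg_mu G dxy); apply: eq_card => z; rewrite !inE.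
by rewrite dist1 andbC.
Qed.

Lemma nbr_split x y : e x y ->
  N y = x |: (common_neighbors e x y :|: [set z | e y z & d x z == 2]).
Proof.
move=> exy; apply/setP=> z; rewrite !inE.
have [->|zx] := eqVneq z x; first by rewrite e_sym exy.
have [eyz|] /= := boolP (e y z); last by rewrite andbF.
rewrite andbT -dist1; have := dist_step x eyz; rewrite (adj_dist1 exy).
have : d x z != 0 by rewrite gdist_eq0 // eq_sym.
by case: (d x z) => [|[|[|]]].
Qed.

Lemma b1E : b 1 + lam + 1 = k.
Proof.
have [x [y dxy]] := pair_at (leq_trans (isT : 1 <= 3) (drg_diam G)).
have exy : e x y by rewrite -dist1 dxy.
rewrite -(cardN y) (nbr_split exy) cardsU1 cardsU.
rewrite (b_num dxy) ?(drg_lam G exy); last exact: leq_trans (drg_diam G).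
rewrite [_ :&: _](_ : _ = set0) ?cards0.
  rewrite !inE (gdistxx _ x) e_irr andbF subn0 /=; lia.
apply/setP=> z; rewrite !inE -dist1; apply/negP=> /andP[/andP[/eqP-> _]].
by rewrite andbF.
Qed.

Lemma mu_le_b1 : mu <= b 1.
Proof. by rewrite -c2E; apply: c_le_b; exact: (drg_diam G). Qed.

(** For a vertex u between two vertices x, y at distance 2, the closed
    neighbourhoods of x and y inside the local graph at u have size lam + 1 and
    share at most mu - 1 of its k vertices: u itself is a common neighbour of x
    and y but not a vertex of the local graph. *)
Lemma b1_lower : k.+1 <= 2 * b 1 + mu.
Proof.
have [x [y dxy]] := pair_at (leq_trans (isT : 2 <= 3) (drg_diam G)).
have [u eyu dxu] := gdist_pred e_sym e_irr e_conn dxy.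
have exu : e x u by rewrite -dist1 dxu.
pose A := x |: common_neighbors e x u; pose B := y |: common_neighbors e y u.
have nxy : ~~ e x y by rewrite -dist1 dxy.
have neq : x != y by rewrite -(gdist_eq0 e_conn) dxy.
have cA : #|A| = lam.+1.
  by rewrite cardsU1 (drg_lam G exu) !inE e_irr add1n.
have cB : #|B| = lam.+1.
  by rewrite cardsU1 (drg_lam G eyu) !inE e_irr add1n.
have cI : #|A :&: B| < mu.
  have := cardsD1 u (common_neighbors e x y); rewrite (drg_mu G dxy).
  rewrite !inE exu eyu => ->; rewrite add1n ltnS; apply: subset_leq_card.
  apply/subsetP=> z; rewrite !inE.
  have [->|zx] := eqVneq z x.
    by rewrite (negPf neq) (e_sym y) (negPf nxy) andbF.
  have [->|zy] := eqVneq z y.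
    by rewrite /= (negPf nxy).
  rewrite /= => /andP[/andP[-> euz] /andP[-> _]]; rewrite !andbT.
  by apply: contraTneq euz => ->; rewrite e_irr.
have cU : #|A :|: B| <= k.
  rewrite -(cardN u); apply: subset_leq_card; apply/subsetP=> z; rewrite !inE.
  by case/orP=> /orP[/eqP->|/andP[_ ->]] //; rewrite e_sym.
have := cardsUI A B; rewrite cA cB => cUI.
have := b1E => b1E; clear -cUI cU cI b1E; lia.
Qed.

(** Both sides count the edges between consecutive spheres. *)
Lemma sphere_count x i : i < D ->
  #|sphere x i| * b i = #|sphere x i.+1| * c i.+1.
Proof.
move=> ltiD.
transitivity (\sum_(y in sphere x i) \sum_(z in sphere x i.+1) e y z).
  rewrite -sum_nat_const; apply: eq_bigr => y; rewrite inE => /eqP dxy.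
  rewrite -(b_num dxy ltiD) -card_set_sum; apply: eq_card => z.
  by rewrite !inE andbC.
rewrite exchange_big /= -sum_nat_const; apply: eq_bigr => z.
rewrite inE => /eqP dxz; rewrite -(c_num dxz).
under eq_bigr do rewrite e_sym.
by rewrite -card_set_sum; apply: eq_card => y; rewrite !inE andbC.
Qed.

Lemma card_sphere0 x : #|sphere x 0| = 1.
Proof.
rewrite -(cards1 x); apply: eq_card => y.
by rewrite !inE gdist_eq0 // eq_sym.
Qed.

Lemma card_sphere1 x : #|sphere x 1| = k.
Proof. by rewrite -(cardN x); apply: eq_card => y; rewrite !inE dist1. Qed.

Lemma card_sphere2 x : mu * #|sphere x 2| = k * b 1.
Proof.
by rewrite mulnC -c2E -sphere_count ?card_sphere1 // ltnW // (drg_diam G).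
Qed.

End DRG.

(** * The third layer *)

Section ThirdLayer.
Variables (T : finType) (e : rel T) (k lam mu : nat) (b c : nat -> nat).
Hypothesis G : drg e k lam mu b c.
Implicit Types (x y z u w : T).

Let e_sym := drg_sym G.
Let e_irr := drg_irr G.
Let e_conn := drg_conn G.
Let D3 := drg_diam G.
Local Notation d := (gdist e).
Local Notation D := (diameter e).
Local Notation CN := (common_neighbors e).

(** For vertices x, y at distance 3, the c_3 neighbours of x on the geodesics
    from x to y. *)
Definition gate x y : {set T} := [set z | e x z & d y z == 2].

Lemma card_gate x y : d x y = 3 -> #|gate x y| = c 3.
Proof. by move=> dxy; apply: (c_num G); rewrite (distC G). Qed.

Lemma common_sub_gate x y z : d x y = 3 -> z \in gate y x -> CN x z \subset gate x y.
Proof.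
move=> dxy; rewrite inE => /andP[eyz _]; apply/subsetP=> w.
rewrite !inE => /andP[exw ezw]; rewrite exw /=.
have := dist_step G y ezw; rewrite (adj_dist1 G eyz) => le2.
have := dist_back G y exw; rewrite (distC G y x) dxy => ge2.
by rewrite eqn_leq le2 -ltnS ge2.
Qed.

Lemma dist_eq2 x y w : x != y -> ~~ e x y -> e x w -> e w y -> d x y = 2.
Proof.
move=> neq ne exw ewy; have := dist_step G x ewy; rewrite (adj_dist1 G exw).
have : d x y != 0 by rewrite gdist_eq0.
have : d x y != 1 by rewrite (dist1 G).
by case: (d x y) => [|[|[|]]].
Qed.

Lemma gate_dist x y z : z \in gate y x -> d x z = 2.
Proof. by rewrite inE => /andP[_ /eqP]. Qed.

Lemma gate_adj x y z : z \in gate y x -> e y z.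
Proof. by rewrite inE => /andP[]. Qed.

(** Suppose c_3 = mu.  Then both gates between vertices at distance 3 are
    cliques, and they are completely joined.  Fix an edge yz, and let U consist
    of the b_1 neighbours u of z at distance 2 from y.  The common neighbours of
    y and u form a gate, and at least mu vertices of U share it; as b_1 < 2 mu,
    all of U shares one gate.  A second point z' of that gate is adjacent to all
    of U, so z and z' have at least b_1 + mu - 1 common neighbours, whereas an
    edge from z into U lies in at most b_1 + mu - 2 triangles. *)
Theorem c3_gt_mu : 1 < mu -> b 1 < 2 * mu -> mu < c 3.
Proof.
move=> mu_gt1 b1_lt; rewrite ltnNge; apply/negP=> c3_le.
have cnE x y z : d x y = 3 -> z \in gate y x -> CN x z = gate x y.
  move=> dxy zg; apply/eqP; rewrite eqEcard common_sub_gate //.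
  by rewrite card_gate // (drg_mu G (gate_dist zg)).
have complete x y z u : d x y = 3 -> z \in gate y x -> u \in gate x y -> e z u.
  by move=> dxy zg; rewrite -(cnE _ _ _ dxy zg) inE => /andP[].
have clique x y z z' : d x y = 3 -> z \in gate y x -> z' \in gate y x ->
    z != z' -> e z z'.
  move=> dxy zg zg' neq; apply/negPn/negP=> ne.
  have dzz : d z z' = 2.
    apply: (@dist_eq2 _ _ y) => //; rewrite ?(e_sym _ y) ?(gate_adj zg) //.
    by rewrite (gate_adj zg').
  have cg : #|gate x y| = mu.
    by rewrite -(cnE _ _ _ dxy zg) (drg_mu G (gate_dist zg)).
  have nyg : y \notin gate x y by rewrite inE gdistxx andbF.
  suff: #|y |: gate x y| <= #|CN z z'|.
    by rewrite (drg_mu G dzz) cardsU1 nyg cg add1n ltnn.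
  apply: subset_leq_card; apply/subsetP=> w; rewrite in_setU1.
  case/orP=> [/eqP->|wg]; rewrite inE.
    by rewrite !(e_sym _ y) (gate_adj zg) (gate_adj zg').
  by rewrite (complete _ _ _ _ dxy zg wg) (complete _ _ _ _ dxy zg' wg).
have [y [x0 dyx0]] := pair_at G D3.
have dx0y : d x0 y = 3 by rewrite (distC G).
have [z eyz dx0z] := gdist_pred e_sym e_irr e_conn dx0y.
pose U := [set u | e z u & d y u == 2].
have cU : #|U| = b 1 by apply: (b_num G); rewrite ?(adj_dist1 G eyz) // ltnW.
have ext u : u \in U -> exists x, [/\ d y x = 3, u \in gate x y,
    z \in gate y x & CN y u = gate y x].
  rewrite inE => /andP[ezu /eqP dyu].
  have [x eux dyx] := b_ext G dyu D3.
  have ug : u \in gate x y by rewrite inE e_sym eux dyu.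
  have dxz : d x z = 2.
    have := dist_step G x (_ : e u z); rewrite e_sym => /(_ ezu).
    rewrite (distC G x u) (adj_dist1 G eux) => le2.
    have := dist_step G x (_ : e z y); rewrite e_sym (distC G x y) dyx => /(_ eyz).
    by rewrite ltnS => ge2; apply/eqP; rewrite eqn_leq le2.
  exists x; split=> //; first by rewrite inE eyz dxz.
  by apply: cnE.
(* a vertex x beyond u has its whole gate towards y inside U *)
have class u : u \in U -> mu <= #|[set v in U | CN y v == CN y u]|.
  move=> Uu; have [x [dyx ug zg cn]] := ext u Uu.
  have dxy : d x y = 3 by rewrite (distC G).
  have <- : #|gate x y| = mu.
    by rewrite -(cnE _ _ _ dxy zg) (drg_mu G (gate_dist zg)).
  apply: subset_leq_card; apply/subsetP=> v vg.
  rewrite 2!inE (complete _ _ _ _ dxy zg vg) (gate_dist vg) eqxx /=.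
  by rewrite (cnE _ _ _ dyx vg) cn.
have same u v : u \in U -> v \in U -> CN y u = CN y v.
  move=> Uu Uv; apply/eqP/negPn/negP=> neq.
  have I0 : [set w in U | CN y w == CN y u] :&: [set w in U | CN y w == CN y v] = set0.
    apply/setP=> w; rewrite [RHS]inE; apply/negP.
    rewrite inE => /andP[]; rewrite inE => /andP[_ /eqP eqw].
    by rewrite inE eqw (negPf neq) andbF.
  have := leq_add (class u Uu) (class v Uv); rewrite -cardsUI I0 cards0 addn0 => le2.
  have : 2 * mu <= b 1.
    rewrite -cU mul2n -addnn; apply: leq_trans le2 _; apply: subset_leq_card.
    by apply/subsetP=> w; rewrite !inE => /orP[] /andP[].
  by rewrite leqNgt b1_lt.
have [u0 Uu0] : exists u, u \in U.
  apply/set0Pn; rewrite -card_gt0 cU; exact: (b_gt0 G (ltnW D3)).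
have [x [dyx ug zg cn0]] := ext u0 Uu0.
have dxy : d x y = 3 by rewrite (distC G).
have cM : #|gate y x| = mu.
  by rewrite -cn0 (drg_mu G) //; move: Uu0; rewrite inE => /andP[_ /eqP].
have cMz : #|gate y x :\ z| = mu.-1 by rewrite -cM (cardsD1 z (gate y x)) zg.
have [z' zg'] : exists z', z' \in gate y x :\ z.
  by apply/set0Pn; rewrite -card_gt0 cMz -ltnS prednK // ltnW.
have ezz' : e z z'.
  move: zg'; rewrite !inE eq_sym => /andP[neq] zg'.
  by apply: (clique x y) => //; rewrite inE.
(* U, y and the rest of the gate are common neighbours of z and z' *)
have low : b 1 + mu - 1 <= lam.
  rewrite -(drg_lam G ezz').
  have sub : U :|: (y |: (gate y x :\ z) :\ z') \subset CN z z'.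
    apply/subsetP=> w; rewrite in_setU => /orP[Uw|].
      have : z' \in CN y w.
        rewrite (same w u0) // cn0; by move: zg'; rewrite inE => /andP[].
      rewrite !inE => /andP[_ ewz']; move: Uw; rewrite inE => /andP[-> _].
      by rewrite e_sym.
    rewrite in_setU1 => /orP[/eqP->|].
      rewrite inE !(e_sym _ y) (gate_adj zg) /=.
      by move: zg'; rewrite !inE => /and3P[].
    rewrite in_setD1 in_setD1 => /and3P[wz' wz wg]; rewrite inE.
    rewrite (clique x y z w dxy zg wg) 1?eq_sym //=.
    by apply: (clique x y) => //; rewrite 1?eq_sym //; move: zg'; rewrite inE => /andP[].
  have I0 : U :&: (y |: (gate y x :\ z) :\ z') = set0.
    apply/setP=> w; rewrite [RHS]inE; apply/negP=> /setIP[].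
    rewrite inE => /andP[_ /eqP dyw]; rewrite !inE -(dist1 G y w) dyw !andbF orbF.
    by move/eqP=> eqwy; move: dyw; rewrite eqwy gdistxx.
  apply: leq_trans (subset_leq_card sub); rewrite cardsU cU I0 cards0 subn0.
  rewrite cardsU1; have := cardsD1 z' (gate y x :\ z); rewrite zg' cMz.
  have -> : y \notin gate y x :\ z :\ z' by rewrite !inE e_irr !andbF.
  clear -mu_gt1; lia.
(* a common neighbour of z and u0 lies in the gate if it is adjacent to y,
   and in U otherwise *)
have high : lam + 2 <= b 1 + mu.
  have ezu0 : e z u0 by move: Uu0; rewrite inE => /andP[].
  have dyu0 : d y u0 = 2 by move: Uu0; rewrite inE => /andP[_ /eqP].
  rewrite -(drg_lam G ezu0).
  have sub : CN z u0 \subset (gate y x :\ z) :|: (U :\ u0).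
    apply/subsetP=> w; rewrite inE => /andP[ezw eu0w].
    have wz : w != z by apply: contraTneq ezw => ->; rewrite e_irr.
    have wu : w != u0 by apply: contraTneq eu0w => ->; rewrite e_irr.
    rewrite in_setU !in_setD1 wz wu -cn0 !inE ezw eu0w /=.
    have := dist_step G y ezw; rewrite (adj_dist1 G eyz) -(dist1 G).
    have : d y w != 0.
      rewrite gdist_eq0 //; apply: contraTneq eu0w => <-.
      by rewrite e_sym -(dist1 G) dyu0.
    by case: (d y w) => [|[|[|]]].
  have := subset_leq_card sub; rewrite cardsU cMz.
  have := cardsD1 u0 U; rewrite Uu0 cU; clear -mu_gt1; lia.
have := leq_trans (leq_add low (leqnn 2)) high; clear -mu_gt1; lia.
Qed.

(** Since c_3 <= b_1, suppose 2 c_3 < 3 mu; then any two points of a gate of y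
    towards x have more than mu/2 common neighbours in the opposite gate.  Two
    non-adjacent points z, z' of the gate would have more than mu/2 common
    neighbours next to x and, by the same count, more than mu/2 next to a vertex
    w adjacent to y and at distance 4 from x; these are too many, as the
    neighbourhoods of x and w are disjoint.  So gates are cliques, and a point u
    of one gate is adjacent to every point z of the other: otherwise the common
    neighbours of u and y and those of x and z would be 2 mu common neighbours
    of u and z.  Hence c_3 <= mu, against [c3_gt_mu]. *)
Theorem b1_ge_three_halves : 3 < D -> 1 < mu -> 3 * mu <= 2 * b 1.
Proof.
move=> D4 mu_gt1; have mu_gt0 := ltnW mu_gt1; rewrite leqNgt; apply/negP=> b1_lt.
have c3_le : c 3 <= b 1 by apply: (c_le_b G).
have c3_lt : 2 * c 3 < 3 * mu by apply: leq_ltn_trans b1_lt; rewrite leq_mul2l.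
have triple x y z z' : d x y = 3 -> z \in gate y x -> z' \in gate y x ->
    2 * mu <= c 3 + #|CN x z :&: CN x z'|.
  move=> dxy zg zg'; rewrite mul2n -addnn.
  rewrite -{1}(drg_mu G (gate_dist zg)) -(drg_mu G (gate_dist zg')) -cardsUI leq_add2r.
  by rewrite -(card_gate dxy) subset_leq_card // subUset !common_sub_gate.
have clique x y z z' : d x y = 3 -> z \in gate y x -> z' \in gate y x ->
    z != z' -> e z z'.
  move=> dxy zg zg' neq; apply/negPn/negP=> ne.
  have dzz : d z z' = 2.
    apply: (@dist_eq2 _ _ y) => //; rewrite ?(e_sym _ y) ?(gate_adj zg) //.
    by rewrite (gate_adj zg').
  have t1 := triple _ _ _ _ dxy zg zg'.
  have [p] : exists p, p \in CN x z :&: CN x z'.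
    by apply/set0Pn; rewrite -card_gt0; move: t1 c3_lt; clear; lia.
  rewrite inE !inE => /andP[/andP[exp ezp] /andP[_ ez'p]].
  have [w eyw dxw] := b_ext G dxy D4.
  have dwgate v : v \in gate y x -> d w v = 2.
    move=> vg; have eyv := gate_adj vg; have dxv := gate_dist vg.
    have := dist_step G w eyv; rewrite (distC G w y) (adj_dist1 G eyw) => le2.
    have := gdist_triangle e_conn v x w; rewrite dxw dxv (distC G v w) => ge2.
    by apply/eqP; rewrite eqn_leq le2 -(leq_add2l 2).
  have dwp : d w p = 3.
    have := dist_step G w ezp; rewrite (dwgate z zg) => le3.
    have := gdist_triangle e_conn p x w.
    rewrite dxw (adj_dist1 G exp) (distC G p w) => ge3.
    by apply/eqP; rewrite eqn_leq le3 -(leq_add2l 1).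
  have zgp : z \in gate p w by rewrite inE e_sym ezp dwgate.
  have zgp' : z' \in gate p w by rewrite inE e_sym ez'p dwgate.
  have t2 := triple _ _ _ _ dwp zgp zgp'.
  have : #|CN x z :&: CN x z'| + #|CN w z :&: CN w z'| <= mu.
    have I0 : (CN x z :&: CN x z') :&: (CN w z :&: CN w z') = set0.
      apply/setP=> v; rewrite !inE; apply/negP.
      case/andP=> /andP[/andP[exv _] _] /andP[/andP[ewv _] _].
      have := gdist_triangle e_conn v x w.
      by rewrite dxw (adj_dist1 G exv) (distC G v w) (adj_dist1 G ewv).
    rewrite -(drg_mu G dzz) -cardsUI I0 cards0 addn0.
    apply: subset_leq_card; apply/subsetP=> v.
    by rewrite !inE => /orP[] /andP[/andP[_ ->] /andP[_ ->]].
  move: t1 t2 c3_lt; clear; lia.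
have [x [y dxy]] := pair_at G D3.
have dyx : d y x = 3 by rewrite (distC G).
have complete u z : u \in gate x y -> z \in gate y x -> e u z.
  move=> ug zg; apply/negPn/negP=> ne.
  have neq : u != z.
    apply: contraTneq ug => ->; rewrite inE -(dist1 G) (gate_dist zg).
    by [].
  have duy := gate_dist ug; rewrite (distC G) in duy.
  have dyu : d y u = 2 by rewrite (distC G).
  have sub1 : CN y u \subset CN u z.
    apply/subsetP=> w cw; have wg := subsetP (common_sub_gate dyx ug) w cw.
    move: cw; rewrite !inE => /andP[eyw euw]; rewrite euw /=.
    apply: (clique x y) => //; apply: contraTneq euw => <-.
    by rewrite (negPf ne).
  have sub2 : CN x z \subset CN u z.
    apply/subsetP=> w cw; have wg := subsetP (common_sub_gate dxy zg) w cw.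
    move: cw; rewrite !inE => /andP[exw ezw]; rewrite ezw andbT.
    apply: (clique y x) => //; apply: contraTneq ezw => <-.
    by rewrite e_sym (negPf ne).
  have disj : CN y u :&: CN x z = set0.
    apply/setP=> w; rewrite !inE; apply/negP=> /andP[/andP[eyw _] /andP[exw _]].
    have := dist_step G x (_ : e w y); rewrite e_sym => /(_ eyw).
    by rewrite (adj_dist1 G exw) dxy.
  have duz : d u z = 2.
    have [w] : exists w, w \in CN y u.
      by apply/set0Pn; rewrite -card_gt0 (drg_mu G dyu).
    move/(subsetP sub1); rewrite inE => /andP[euw ezw].
    by apply: (@dist_eq2 _ _ w) => //; rewrite e_sym.
  have : #|CN y u :|: CN x z| <= #|CN u z|.
    by rewrite subset_leq_card // subUset sub1.
  rewrite cardsU disj cards0 subn0 (drg_mu G dyu) (drg_mu G (gate_dist zg)).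
  rewrite (drg_mu G duz).
  by rewrite -{3}(addn0 mu) leq_add2l leqNgt mu_gt0.
have c3_le_mu : c 3 <= mu.
  have [u exu dyu] := gdist_pred e_sym e_irr e_conn dyx.
  have ug : u \in gate x y by rewrite inE exu dyu.
  rewrite -(card_gate dyx) -(drg_mu G dyu); apply: subset_leq_card.
  apply/subsetP=> z zg; rewrite inE (gate_adj zg); exact: complete.
have : mu < c 3 by apply: c3_gt_mu => //; move: b1_lt; clear; lia.
by rewrite ltnNge c3_le_mu.
Qed.

End ThirdLayer.

(** * Radial flows *)

Definition edge_cut (T : finType) (e : rel T) (A : {set T}) : nat :=
  \sum_(w in A) #|[set z | e w z] :\: A|.

Section Flow.
Variables (T : finType) (e : rel T) (k lam mu : nat) (b c : nat -> nat).
Hypothesis G : drg e k lam mu b c.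
Implicit Types (x y z u w : T) (A S : {set T}).

Let e_sym := drg_sym G.
Let e_conn := drg_conn G.
Local Notation d := (gdist e).
Local Notation D := (diameter e).
Local Notation N x := [set z | e x z] (only parsing).
Local Open Scope ring_scope.

Variable x : T.

(** Let every vertex other than x absorb one unit that is sent from x along
    geodesics, evenly divided.  What is absorbed at distance i or more passes
    through the sphere of radius i: [inflow i] is what enters a vertex at
    distance i, and [flow i] is what runs along an edge from distance i to
    distance i + 1. *)
Definition beyond i := #|[set y | (i <= d x y)%N]|.
Definition inflow i : rat := (beyond i)%:R / #|sphere e x i|%:R.
Definition flow i : rat := inflow i.+1 / (c i.+1)%:R.

Lemma beyond_rec i : beyond i = (#|sphere e x i| + beyond i.+1)%N.
Proof.
have I0 : sphere e x i :&: [set y | (i.+1 <= d x y)%N] = set0.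
  by apply/setP=> y; rewrite !inE; case: eqVneq => // ->; rewrite ltnn.
rewrite /beyond -cardsUI I0 cards0 addn0; apply: eq_card => y.
by rewrite !inE leq_eqVlt eq_sym.
Qed.

Lemma beyond0 : beyond 0 = #|T|.
Proof. by rewrite /beyond; apply: eq_card => y; rewrite !inE. Qed.

Lemma beyond1 : beyond 1 = (#|T| - 1)%N.
Proof. by rewrite -beyond0 (beyond_rec 0) (card_sphere0 G) addKn. Qed.

Lemma beyond2 : beyond 2 = (#|T| - 1 - k)%N.
Proof. by rewrite -beyond1 (beyond_rec 1) (card_sphere1 G) addKn. Qed.

Lemma beyond_gt i : (D < i)%N -> beyond i = 0%N.
Proof.
move=> ltDi; apply/eqP; rewrite cards_eq0; apply/eqP/setP=> y; rewrite !inE.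
by apply: contraTF ltDi => le; rewrite -leqNgt (leq_trans le) // gdist_diameter.
Qed.

Lemma sphere_all_gt0 i : (i <= D)%N -> (0 < #|sphere e x i|)%N.
Proof.
elim: i => [|i IHi] ltiD; first by rewrite (card_sphere0 G).
have := sphere_count G x ltiD; have := b_gt0 G ltiD.
have := IHi (ltnW ltiD); case: #|sphere e x i.+1| => //.
by move=> K_gt0 b_gt0 /eqP; rewrite mul0n muln_eq0 !eqn0Ngt K_gt0 b_gt0.
Qed.

Lemma inflow_ge0 i : 0 <= inflow i.
Proof. by rewrite divr_ge0. Qed.

Lemma flow_ge0 i : 0 <= flow i.
Proof. by rewrite divr_ge0 ?inflow_ge0. Qed.

Lemma inflow_diam : inflow D = 1.
Proof.
rewrite /inflow beyond_rec beyond_gt // addn0 divff // pnatr_eq0 -lt0n.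
exact: sphere_all_gt0.
Qed.

Lemma inflow_rec i : (i < D)%N -> inflow i = 1 + (b i)%:R * flow i.
Proof.
move=> ltiD; rewrite /flow /inflow beyond_rec.
have K0 : (#|sphere e x i|%:R != 0 :> rat).
  by rewrite pnatr_eq0 -lt0n sphere_all_gt0 // ltnW.
have K1 : (#|sphere e x i.+1|%:R != 0 :> rat) by rewrite pnatr_eq0 -lt0n sphere_all_gt0.
have c0 : ((c i.+1)%:R != 0 :> rat) by rewrite pnatr_eq0 -lt0n (c_gt0 G).
have b0 : ((b i)%:R != 0 :> rat) by rewrite pnatr_eq0 -lt0n (b_gt0 G).
have /(congr1 (fun n => n%:R : rat)) := sphere_count G x ltiD.
rewrite !natrM natrD => eqK.
have -> : (b i)%:R = #|sphere e x i.+1|%:R * (c i.+1)%:R / #|sphere e x i|%:R :> rat.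
  by rewrite -eqK; field.
by field; rewrite K0 K1 c0.
Qed.

Lemma inflowE i u : d x u = i.+1 ->
  \sum_(w | e w u && (d x u == (d x w).+1)) flow (d x w) = inflow i.+1.
Proof.
move=> dxu; rewrite (eq_bigr (fun=> flow i)) => [|w /andP[_]]; last first.
  by rewrite dxu eqSS => /eqP->.
rewrite sumr_const /flow -mulr_natl.
have -> : #|[pred w | e w u & d x u == (d x w).+1]| = c i.+1.
  rewrite -(c_num G dxu); apply: eq_card => w.
  by rewrite !inE e_sym dxu eqSS eq_sym.
have c0 : ((c i.+1)%:R != 0 :> rat).
  by rewrite pnatr_eq0 -lt0n (c_gt0 G) // -dxu gdist_diameter.
by field.
Qed.

(** What enters minus what leaves is the unit absorbed at u; on the last sphere
    nothing leaves. *)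
Lemma conservation i u : d x u = i.+1 ->
  \sum_(w | e w u && (d x u == (d x w).+1)) flow (d x w)
  - \sum_(w | e u w && (d x w == (d x u).+1)) flow (d x u) = 1.
Proof.
move=> dxu; rewrite (inflowE dxu).
have leD : (i.+1 <= D)%N by rewrite -dxu gdist_diameter.
rewrite dxu sumr_const -mulr_natl; have [ltiD|geD] := ltnP i.+1 D.
  rewrite (inflow_rec ltiD) -(b_num G dxu ltiD).
  rewrite [X in _ - X%:R * _](_ : _ = #|[set z | e u z & d x z == i.+2]|).
    by rewrite addrK.
  by apply: eq_card => w; rewrite !inE.
have eqD : i.+1 = D by apply/eqP; rewrite eqn_leq leD.
rewrite eqD inflow_diam eq_card0 ?mul0r ?subr0 // => w.
rewrite !inE; apply/negP=> /andP[_ /eqP dw].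
by have := gdist_diameter e x w; rewrite dw ?eqD ltnn.
Qed.

(** Sum the conservation law over the complement of A: flow between two
    vertices of the complement cancels, and flow back into A only helps. *)
Lemma flow_cut A : x \in A ->
  #|~: A|%:R <= \sum_(w in A) \sum_(u in ~: A | e w u && (d x u == (d x w).+1))
                  flow (d x w).
Proof.
move=> Ax; pose g w u := if e w u && (d x u == (d x w).+1) then flow (d x w) else 0.
have g_ge0 w u : 0 <= g w u by rewrite /g; case: ifP => // _; apply: flow_ge0.
have -> : #|~: A|%:R = \sum_(u in ~: A) (\sum_w g w u - \sum_w g u w).
  rewrite -sum1_card natr_sum; apply: eq_bigr => u; rewrite inE => nAu.
  have [i dxu] : exists i, d x u = i.+1.
    have : d x u != 0%N by rewrite gdist_eq0 //; apply: contraNneq nAu => <-.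
    by case: (d x u) => // i _; exists i.
  by rewrite /g -!big_mkcond (conservation dxu).
rewrite sumrB.
have split_sum (h : T -> T -> rat) : \sum_(u in ~: A) \sum_w h u w =
    \sum_(u in ~: A) \sum_(w in A) h u w + \sum_(u in ~: A) \sum_(w in ~: A) h u w.
  rewrite -big_split /=; apply: eq_bigr => u _.
  by rewrite (bigID (mem A)) /=; congr (_ + _); apply: eq_bigl => w; rewrite inE.
rewrite (split_sum g) (split_sum (fun u w => g w u)).
rewrite [X in _ + X - _]exchange_big /= [X in _ - X]addrC addrKA.
have -> : \sum_(w in A) \sum_(u in ~: A | e w u && (d x u == (d x w).+1)) flow (d x w)
    = \sum_(u in ~: A) \sum_(w in A) g w u.
  rewrite exchange_big /=; apply: eq_bigr => w _.
  by rewrite big_mkcondr.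
rewrite lerBlDr lerDl; apply: sumr_ge0 => u _; exact: sumr_ge0.
Qed.

(** By downward induction from the last sphere: by [inflow_rec] the excess of
    an inflow over 1 is the next inflow times b_i / c_(i+1), and these ratios
    decrease with i. *)
Lemma inflow_noninc i : (i.+1 <= D)%N -> inflow i.+1 <= inflow i.
Proof.
elim: {i}(D - i)%N {-2}i (erefl (D - i)%N) => [|n IHn] i eqn leD.
  by move: leD; rewrite ltnNge -subn_eq0 eqn.
rewrite (inflow_rec leD).
have [eqD|neqD] := eqVneq i.+1 D.
  by rewrite eqD inflow_diam lerDl mulr_ge0 ?flow_ge0.
have ltD : (i.+1 < D)%N by rewrite ltn_neqAle neqD.
rewrite (inflow_rec ltD) lerD2l /flow.
apply: ler_pM; rewrite ?divr_ge0 ?inflow_ge0 ?ler_nat ?(b_noninc G) //.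
apply: ler_pM; rewrite ?invr_ge0 ?inflow_ge0 //.
  by apply: IHn => //; rewrite subnS eqn.
rewrite lef_pV2 ?posrE ?ltr0n ?(c_gt0 G) // ler_nat.
exact: (c_nondec G).
Qed.

Lemma flow_noninc i : (i.+1 < D)%N -> flow i.+1 <= flow i.
Proof.
move=> ltD; apply: ler_pM; rewrite ?invr_ge0 ?inflow_ge0 ?inflow_noninc //.
rewrite lef_pV2 ?posrE ?ltr0n ?(c_gt0 G) // ?ler_nat ?(c_nondec G) //.
exact: ltnW.
Qed.

Let D2 : (2 < D)%N := drg_diam G.

Lemma inflow_le2 i : (1 < i <= D)%N -> inflow i <= inflow 2.
Proof.
elim: i => // i IHi; rewrite ltnS leq_eqVlt => /andP[/orP[/eqP<-//|lt1i] leD].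
apply: le_trans (inflow_noninc leD) _.
by apply: IHi; rewrite lt1i ltnW.
Qed.

Lemma flow_le1 i : (0 < i < D)%N -> flow i <= flow 1.
Proof.
elim: i => // i IHi; rewrite ltnS leq_eqVlt => /andP[/orP[/eqP<-//|lt1i] leD].
apply: le_trans (flow_noninc leD) _.
by apply: IHi; rewrite lt1i ltnW.
Qed.

Hypothesis k_gt0 : (0 < k)%N.

Lemma flow0E : flow 0 * k%:R = (#|T| - 1)%:R.
Proof.
rewrite /flow /inflow (c1E G) beyond1 (card_sphere1 G).
have k0 : (k%:R != 0 :> rat) by rewrite pnatr_eq0 -lt0n.
by field.
Qed.

Lemma inflow1E : inflow 1 * k%:R = (#|T| - 1)%:R.
Proof.
rewrite /inflow beyond1 (card_sphere1 G).
have k0 : (k%:R != 0 :> rat) by rewrite pnatr_eq0 -lt0n.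
by field.
Qed.

Lemma inflow2E : inflow 2 * (k * b 1)%:R = (mu * (#|T| - 1 - k))%:R.
Proof.
rewrite /inflow beyond2 -(card_sphere2 G x) !natrM.
have K0 : (#|sphere e x 2|%:R != 0 :> rat).
  by rewrite pnatr_eq0 -lt0n sphere_all_gt0 // ltnW.
by field.
Qed.

Lemma flow1E : flow 1 * (k * b 1)%:R = (#|T| - 1 - k)%:R.
Proof.
have mu0 : ((c 2)%:R != 0 :> rat) by rewrite pnatr_eq0 -lt0n (c_gt0 G) // ltnW.
apply: (mulfI mu0); rewrite /flow mulrA [X in X * _ = _]mulrC divfK //.
by rewrite inflow2E natrM (c2E G).
Qed.

(** An edge at x carries (v-1)/k, any other at most (v-1-k)/(k b_1); the
    inequality of [flow_cut] is multiplied by k b_1. *)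
Theorem edge_flow A (a := #|N x :\: A|) : x \in A ->
  (k * b 1 * #|~: A| <=
     b 1 * a * (#|T| - 1) + (edge_cut e A - a) * (#|T| - 1 - k))%N.
Proof.
move=> Ax; have := flow_cut Ax.
have out w : #|[set z | e w z] :\: A| = #|[pred u in ~: A | e w u]|.
  by apply: eq_card => u; rewrite !inE andbC.
have le_out w : w \in A -> w != x ->
    \sum_(u in ~: A | e w u && (d x u == (d x w).+1)) flow (d x w)
      <= flow 1 * #|[set z | e w z] :\: A|%:R.
  move=> Aw neqwx.
  apply: (@le_trans _ _ (\sum_(u in ~: A | e w u) flow 1)).
    rewrite big_mkcond [leRHS]big_mkcond; apply: ler_sum => u _ /=.
    case: (_ \in _) => //=; case: (e w u) => //=.
    case: ifP => [/eqP dxu|_]; last exact: flow_ge0.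
    apply: flow_le1; rewrite lt0n gdist_eq0 // eq_sym neqwx /=.
    by rewrite -dxu gdist_diameter.
  by rewrite sumr_const mulr_natr out.
have le_x : \sum_(u in ~: A | e x u && (d x u == (d x x).+1)) flow (d x x)
      <= flow 0 * a%:R.
  rewrite gdistxx sumr_const mulr_natr /a out.
  rewrite -[leLHS]mulr_natl -[leRHS]mulr_natl.
  apply: ler_wpM2r; first exact: flow_ge0.
  rewrite ler_nat; apply: subset_leq_card; apply/subsetP=> u.
  by rewrite !inE unfold_in inE; case: (u \in A); case: (e x u).
rewrite (bigD1 x Ax) /= => le_tot.
have {le_tot le_out le_x} : #|~: A|%:R <= flow 0 * a%:R + flow 1 * (edge_cut e A - a)%:R.
  apply: le_trans le_tot _; apply: lerD; first exact: le_x.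
  rewrite /edge_cut (bigD1 x Ax) /= -/a addKn natr_sum mulr_sumr.
  by apply: ler_sum => w /andP[]; apply: le_out.
rewrite -(ler_nat rat) natrD !natrM => le_tot.
have := ler_wpM2l (ler0n rat (k * b 1)) le_tot; rewrite natrM; congr (_ <= _).
transitivity ((b 1)%:R * a%:R * (flow 0 * k%:R) +
   (edge_cut e A - a)%:R * (flow 1 * (k * b 1)%:R)); first by rewrite natrM; ring.
by rewrite flow0E flow1E.
Qed.

(** All the flow out of A enters S: at most (v-1)/k at a neighbour of x, at most
    mu (v-1-k)/(k b_1) at any other vertex. *)
Theorem vertex_flow A S (n := #|N x :&: S|) : x \in A -> [disjoint A & S] ->
    (forall w u, w \in A -> u \notin A -> e w u -> u \in S) ->
  (k * b 1 * #|~: A| <=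
     b 1 * n * (#|T| - 1) + mu * (#|S| - n) * (#|T| - 1 - k))%N.
Proof.
move=> Ax dAS sepA; have := flow_cut Ax.
under [leRHS]eq_bigr do rewrite big_mkcondr.
rewrite exchange_big /= => le_tot.
have Sx u : u \in S -> u \notin A by move=> Su; rewrite (disjointFl dAS).
have le_u u : u \in S ->
    \sum_(w in A) (if e w u && (d x u == (d x w).+1) then flow (d x w) else 0)
      <= inflow (d x u).
  move=> Su; have [i dxu] : exists i, d x u = i.+1.
    have : d x u != 0%N by rewrite gdist_eq0 //; apply: contraNneq (Sx u Su) => <-.
    by case: (d x u) => // i _; exists i.
  rewrite dxu -(inflowE dxu) dxu big_mkcond [leRHS]big_mkcond /=.
  apply: ler_sum => w _; case: (w \in A) => //=.
  by case: ifP => // _; apply: flow_ge0.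
have {le_tot} : #|~: A|%:R <= \sum_(u in S) inflow (d x u).
  apply: le_trans le_tot _; rewrite big_mkcond [leRHS]big_mkcond /=.
  apply: ler_sum => u _; rewrite inE; have [Su|nSu] := boolP (u \in S).
    by rewrite Sx //=; apply: le_u.
  case: ifP => // nAu; rewrite big1 // => w Aw; case: ifP => // /andP[ewu _].
  by case/negP: nSu; apply: sepA ewu.
have le_in u : u \in S -> inflow (d x u) <=
    (if u \in N x then inflow 1 else inflow 2).
  move=> Su; rewrite inE -(dist1 G); case: eqP => [->//|neq1].
  apply: inflow_le2; rewrite gdist_diameter andbT.
  have : d x u != 0%N by rewrite gdist_eq0 //; apply: contraNneq (Sx u Su) => <-.
  by move: neq1; case: (d x u) => [|[|]].
move/le_trans/(_ (ler_sum _ le_in)).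
have -> : \sum_(u in S) (if u \in N x then inflow 1 else inflow 2) =
    inflow 1 * n%:R + inflow 2 * (#|S| - n)%:R.
  rewrite (bigID (mem (N x))) /=; congr (_ + _).
    rewrite (eq_bigr (fun=> inflow 1)) => [|u /andP[_ ->]] //.
    rewrite sumr_const mulr_natr; congr (_ *+ _).
    by apply: eq_card => u; rewrite [LHS]unfold_in /= !inE andbC.
  rewrite (eq_bigr (fun=> inflow 2)) => [|u /andP[_ /negPf->]] //.
  rewrite sumr_const mulr_natr; congr (_ *+ _).
  rewrite -(cardsID (N x) S) setIC addKn.
  by apply: eq_card => u; rewrite [LHS]unfold_in /= !inE andbC.
rewrite -(ler_nat rat) natrD !natrM => le_tot.
have := ler_wpM2l (ler0n rat (k * b 1)) le_tot; rewrite natrM; congr (_ <= _).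
transitivity ((b 1)%:R * n%:R * (inflow 1 * k%:R) +
   (#|S| - n)%:R * (inflow 2 * (k * b 1)%:R)); first by rewrite natrM; ring.
by rewrite inflow1E inflow2E natrM; ring.
Qed.

End Flow.

(** * Edge cuts *)

(** Here m is the size of the smaller side, a the least number of outgoing edges
    at one of its vertices, and the last hypothesis is [edge_flow] for a cut of
    3k - 7 edges.  Since v - m is at least v/2, it forces
    k b_1 < 2 a b_1 + 2 (3k - 7 - a). *)
Lemma cut_parameters_bounded k b1 a m v :
  6 <= k -> k + 1 <= 3 * b1 -> b1 + 2 <= k ->
  a * m <= 3 * k - 7 -> k - 1 <= m -> 2 * m <= v -> k < v ->
  k * b1 * (v - m) <= b1 * a * (v - 1) + (3 * k - 7 - a) * (v - 1 - k) ->
  [/\ a <= 2, b1 <= 7 & k * b1 < 2 * a * b1 + 2 * (3 * k - 7 - a)].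
Proof.
move=> k6 kb bk am km mv kv ineq.
have a2 : a <= 2.
  rewrite leqNgt; apply/negP=> a3.
  have : 3 * (k - 1) <= a * m by apply: leq_mul.
  lia.
have key : k * b1 < 2 * a * b1 + 2 * (3 * k - 7 - a).
  rewrite ltnNge; apply/negP=> ge.
  have h1 : k * b1 * v <= 2 * (k * b1 * (v - m)).
    by rewrite mulnCA leq_mul2l; lia.
  have h2 : (2 * a * b1 + 2 * (3 * k - 7 - a)) * v <= k * b1 * v.
    by rewrite leq_mul2r ge orbT.
  have h3 : b1 * a * (v - 1) <= b1 * a * v by rewrite leq_mul2l leq_subr orbT.
  have h4 : (3 * k - 7 - a) * (v - 1 - k) < (3 * k - 7 - a) * v.
    by rewrite ltn_mul2l; lia.
  move: h1 h2 h3 h4 ineq; move: (v - m) (v - 1) (v - 1 - k) (3 * k - 7 - a) => p q r s.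
  clear; nia.
split=> //.
by case: a a2 key {am ineq} => [|[|[|//]]] _; clear -k6 bk; nia.
Qed.

(** K2 and K3 are the sizes of the spheres of radius 2 and 3.  By the bounds
    above only finitely many triples (k, b_1, mu) and values of a remain; for
    each of them the flow inequality is linear in v, m, K2 and K3 and contradicts
    the bounds on v, except for b_1 = mu = 3, a = 1, D = 3 and k = 7 or 8.  There
    c_3 >= 4 and the parity of v leave only K3 = 5, which violates
    c_3 K3 = b_2 K2. *)
Lemma cut_parameters_absurd k b1 mu a m v K2 K3 b2 c3 :
  3 <= mu -> 2 * mu <= k -> mu <= b1 -> k + 1 <= 2 * b1 + mu -> b1 + 2 <= k ->
  mu * K2 = k * b1 -> 1 + k + K2 < v ->
  (3 * mu <= 2 * b1) \/
    [/\ v = 1 + k + K2 + K3, c3 * K3 = b2 * K2, b2 <= b1, mu <= c3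
      & b1 < 2 * mu -> mu < c3] ->
  a * m <= 3 * k - 7 -> k - 1 <= m -> 2 * m <= v -> ~~ odd v ->
  k * b1 * (v - m) <= b1 * a * (v - 1) + (3 * k - 7 - a) * (v - 1 - k) -> False.
Proof.
move=> mu3 muk mub kb bk muK vlow alt am km mv ev ineq.
have k6 : 6 <= k by lia.
have kb3 : k + 1 <= 3 * b1 by lia.
have kv : k < v by lia.
have [a2 b7 key] := cut_parameters_bounded k6 kb3 bk am km mv kv ineq.
have b3 : 3 <= b1 by lia.
have {}alt : (3 * mu <= 2 * b1) \/
    [/\ v = 1 + k + K2 + K3, mu * K3 <= b1 * K2, c3 * K3 = b2 * K2, b2 <= b1 & 
       b1 < 2 * mu -> mu < c3].
  case: alt => [|[vE cK bb cc cm]]; [by left | right; split=> //].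
  by apply: (@leq_trans (c3 * K3)); rewrite ?leq_mul2r ?cc ?orbT // cK leq_mul2r bb orbT.
have km' : k <= m + 1 by lia.
clear km.
case: a a2 key ineq am => [|[|[|//]]] _ key ineq am;
  (have : b1 = 3 \/ b1 = 4 \/ b1 = 5 \/ b1 = 6 \/ b1 = 7 by clear -b3 b7; lia);
  case=> [|[|[|[|]]]] b1E; subst b1;
  (have k18 : k <= 18 by clear -kb3 key; lia).
all: have : k = 6 \/ k = 7 \/ k = 8 \/ k = 9 \/ k = 10 \/ k = 11 \/ k = 12 \/
  k = 13 \/ k = 14 \/ k = 15 \/ k = 16 \/ k = 17 \/ k = 18 by clear -k6 k18; lia.
all: case=> [|[|[|[|[|[|[|[|[|[|[|[|]]]]]]]]]]]] kE; subst k;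
  try (clear -kb3 bk key; exfalso; lia).
all: (have : mu = 3 \/ mu = 4 \/ mu = 5 \/ mu = 6 \/ mu = 7 by clear -mu3 mub b7; lia).
all: case=> [|[|[|[|]]]] muE; subst mu;
  try (clear -muk mub kb; exfalso; lia).
all: clear kb3 bk key muk mub kb mu3 b3 b7 k18 k6 kv.
all: case: alt => [alt|[vE K3le cK bb cc]];
  [try by clear -ineq muK vlow alt am km' mv ev; lia | 
   try by clear -ineq muK vE vlow K3le am km' mv ev; lia].
(* the two surviving triples *)
all: have c4 : 4 <= c3 by apply: cc.
all: have K3c : 4 * K3 <= b2 * K2 by rewrite -cK leq_mul2r c4 orbT.
- have K2E : K2 = 7 by clear -muK; lia.
  subst K2; have K3E : K3 = 5 by clear -ineq vE K3le K3c bb am mv ev; lia.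
  by subst K3; clear -cK bb c4; lia.
- have K2E : K2 = 8 by clear -muK; lia.
  subst K2; have K3E : K3 = 5 by clear -ineq vE K3le K3c bb am mv ev; lia.
  by subst K3; clear -cK bb c4; lia.
Qed.

Section Cut.
Variables (T : finType) (e : rel T) (k lam mu : nat) (b c : nat -> nat).
Hypothesis G : drg e k lam mu b c.
Implicit Types (x y z u w : T) (A : {set T}).

Let e_sym := drg_sym G.
Let e_irr := drg_irr G.
Let D3 := drg_diam G.
Local Notation D := (diameter e).

Lemma edge_cutE A : edge_cut e A = \sum_(w in A) \sum_(u in ~: A) e w u.
Proof.
apply: eq_bigr => w _; rewrite -card_set_sum; apply: eq_card => u.
by rewrite !inE.
Qed.

Lemma edge_cutC A : edge_cut e (~: A) = edge_cut e A.
Proof.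
rewrite !edge_cutE setCK exchange_big /=.
by apply: eq_bigr => w _; apply: eq_bigr => u _; rewrite e_sym.
Qed.

(** The order of the graph is controlled in one of two ways: if D = 3 by k and
    the two outer spheres, and if D > 3 through the lower bound on b_1, which
    makes k_2 large. *)
Lemma diameter_regimes x (K2 := #|sphere e x 2|) (K3 := #|sphere e x 3|) : 1 < mu ->
  [/\ mu * K2 = k * b 1, 1 + k + K2 < #|T| &
  (3 * mu <= 2 * b 1) \/
    [/\ #|T| = 1 + k + K2 + K3, c 3 * K3 = b 2 * K2, b 2 <= b 1, mu <= c 3
      & b 1 < 2 * mu -> mu < c 3]].
Proof.
move=> mu_gt1.
have vE : #|T| = 1 + k + K2 + (K3 + beyond e x 4).
  rewrite -(beyond0 e x) 4!beyond_rec (card_sphere0 G) (card_sphere1 G).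
  by rewrite !addnA.
have K3_gt0 : 0 < K3 := sphere_all_gt0 G x D3.
split; first exact: (card_sphere2 G).
  by rewrite vE; clear -K3_gt0; lia.
have [D4|D_le3] := ltnP 3 D; first by left; apply: (b1_ge_three_halves G).
right; split.
- by rewrite vE (beyond_gt (e := e) x (D_le3 : D < 4)) addn0.
- by rewrite mulnC -(sphere_count G) // mulnC.
- exact: (b_noninc G D3).
- by rewrite -(c2E G); apply: (c_nondec G).
- exact: (c3_gt_mu G).
Qed.

Hypothesis lam_gt0 : 0 < lam.
Hypothesis mu_ge3 : 2 < mu.
Hypothesis mu_le : 2 * mu <= k.
Hypothesis evenT : ~~ odd #|T|.

(** Let A be the smaller side and suppose it has at most 3k - 7 outgoing edges.
    A vertex of A has at most |A| - 1 neighbours inside, so the cut has at least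
    |A| (k + 1 - |A|) edges, which is enough when 3 <= |A| <= k - 2.  Otherwise
    some vertex of A has at most two outgoing edges, and the flow from it
    contradicts the arithmetic of the parameters. *)
Theorem edge_cut_ge A : 3 <= #|A| -> 3 <= #|~: A| -> 3 * k - 6 <= edge_cut e A.
Proof.
wlog le_half : A / #|A| <= #|~: A|.
  move=> IH A3 cA3; have [le|/ltnW le] := leqP #|A| #|~: A|; first exact: IH.
  by rewrite -edge_cutC; apply: IH; rewrite ?setCK.
move=> A3 _; rewrite leqNgt; apply/negP=> E_lt.
have small : #|A| * (k.+1 - #|A|) <= edge_cut e A.
  rewrite -sum_nat_const; apply: leq_sum => w Aw.
  rewrite cardsD (drg_val G).
  have sub : [set z | e w z] :&: A \subset A :\ w.
    apply/subsetP=> z; rewrite !inE => /andP[ewz ->]; rewrite andbT.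
    by apply: contraTneq ewz => ->; rewrite e_irr.
  have := subset_leq_card sub; have := cardsD1 w A; rewrite Aw.
  by clear; lia.
have k6 : 6 <= k by move: mu_le mu_ge3; clear; lia.
have A_ge : k - 1 <= #|A|.
  rewrite leqNgt; apply/negP=> A_lt.
  have : 3 * (k - 2) <= #|A| * (k.+1 - #|A|).
    move: A3 A_lt k6; move: #|A| => m; clear => m3 mk k6.
    have [p mE] : exists p, m = 3 + p by exists (m - 3); lia.
    have [r kE] : exists r, k = m + 2 + r by exists (k - m - 2); lia.
    have -> : k.+1 - m = 3 + r by lia.
    have -> : k - 2 = 3 + p + r by lia.
    rewrite mE; nia.
  by move: small E_lt; clear; lia.
have [x0 Ax0] : exists x, x \in A.
  by apply/set0Pn; rewrite -card_gt0; apply: leq_trans A3.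
case: (arg_minnP (fun x => #|[set z | e x z] :\: A|) Ax0) => x Ax minx.
have aE : #|[set z | e x z] :\: A| * #|A| <= edge_cut e A.
  by rewrite mulnC -sum_nat_const; apply: leq_sum => w /minx.
have flow := edge_flow G (_ : 0 < k) Ax.
have [muK vlow alt] := diameter_regimes x (ltnW mu_ge3).
have cA : #|~: A| = #|T| - #|A| by rewrite -(cardsC A) addKn.
apply: (cut_parameters_absurd mu_ge3 mu_le (mu_le_b1 G) _ _ muK vlow alt _ A_ge _
         evenT (a := #|[set z | e x z] :\: A|)).
- by rewrite addn1 (b1_lower G).
- by rewrite -(b1E G); move: lam_gt0; clear; lia.
- by move: aE E_lt; clear; lia.
- by rewrite -(cardsC A) mul2n -addnn leq_add2l.
- rewrite -cA; apply: leq_trans (flow _) _; first exact: leq_trans k6.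
  rewrite leq_add2l leq_mul2r; apply/orP; right.
  by apply: leq_sub2r; move: E_lt; clear; lia.
Qed.

End Cut.

(** * Averaging the flow over the members of a barrier *)

Section Quadratics.
Local Open Scope ring_scope.
Variable R : realFieldType.
Implicit Types k p W s q Lam Q Y v : R.

(** In this section K2 = k_2 and W = v - 1 = k + k_2 + ..., so that
    k K3 <= K2^2 expresses k_3 / k_2 <= k_2 / k, which holds because b_2 <= b_1
    and mu <= c_3. *)
Lemma order_le_diam3 k K2 K3 W : 0 < k -> k <= K2 -> 3 * K2 <= 4 * k ->
  W = k + K2 + K3 -> k * K3 <= K2 ^+ 2 -> 2 * W <= 9 * k.
Proof.
move=> k0 kK Kk -> kK3.
have h : K2 ^+ 2 <= (4 / 3 * k) * (4 / 3 * k).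
  by rewrite expr2; apply: ler_pM; lra.
have h2 : k * K3 <= k * (16 / 9 * k) by apply: le_trans kK3 _; nra.
have h3 : K3 <= 16 / 9 * k by rewrite -(ler_pM2l k0).
lra.
Qed.

(** With rho = K2/k and omega = W/k the quadratic is
    (4 - 3 rho) omega^2 + (4 rho - 10) omega + 6.  For rho > 4/3 it is negative
    beyond omega = 1 + rho; for smaller rho it is convex in omega, which is then
    confined to the interval from 2 to 9/2. *)
Lemma quadratic_two k K2 W : 0 < k -> k <= K2 -> k + K2 <= W ->
    (3 * K2 <= 4 * k -> 2 * W <= 9 * k) ->
  (4 * k - 3 * K2) * W ^+ 2 + (4 * k * K2 - 10 * k ^+ 2) * W + 6 * k ^+ 3 <= 0.
Proof.
move=> k0 kK KW Wup.
have W0 : 0 < W by lra.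
have [le|lt] := lerP (3 * K2) (4 * k).
  have Wk := Wup le.
  have h1 : 0 <= k * ((W - 2 * k) * (9 / 2 * k - W)).
    by apply: mulr_ge0; [lra | apply: mulr_ge0; lra].
  have h2 : 0 <= k * (k * (6 * k - W)).
    by apply: mulr_ge0; [lra | apply: mulr_ge0; lra].
  have h3 : 0 <= (K2 - k) * (W * (3 * W - 4 * k)).
    by apply: mulr_ge0; [lra | apply: mulr_ge0; lra].
  lra.
have h1 : 0 <= (3 * K2 - 4 * k) * (W * (W - 4 / 3 * k)).
  by apply: mulr_ge0; [lra | apply: mulr_ge0; lra].
have h2 : 0 <= k * (k * (W - 9 / 7 * k)).
  by apply: mulr_ge0; [lra | apply: mulr_ge0; lra].
lra.
Qed.

(** The analogue of [quadratic_two] for three or more members, with the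
    threshold 7/6 in place of 4/3. *)
Lemma quadratic_many k K2 W : 0 < k -> k <= K2 -> k + K2 <= W ->
    (3 * K2 <= 4 * k -> 2 * W <= 9 * k) ->
  (7 * k - 6 * K2) * W ^+ 2 + (10 * k * K2 - 17 * k ^+ 2) * W + 10 * k ^+ 3 <= 0.
Proof.
move=> k0 kK KW Wup.
have W0 : 0 < W by lra.
have [le|lt] := lerP (6 * K2) (7 * k).
  have Wk : 2 * W <= 9 * k by apply: Wup; lra.
  have h1 : 0 <= k * ((W - 2 * k) * (5 * k - W)).
    by apply: mulr_ge0; [lra | apply: mulr_ge0; lra].
  have h3 : 0 <= (K2 - k) * (W * (3 * W - 5 * k)).
    by apply: mulr_ge0; [lra | apply: mulr_ge0; lra].
  lra.
have h1 : 0 <= (6 * K2 - 7 * k) * (W * (W - 5 / 3 * k)).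
  by apply: mulr_ge0; [lra | apply: mulr_ge0; lra].
have h2 : 0 <= k * (k * (W - 15 / 8 * k)).
  by apply: mulr_ge0; [lra | apply: mulr_ge0; lra].
lra.
Qed.

(** The summed flow inequality for q = 2.  The bound 3s <= 2k gives
    s W <= 2 Lam, which removes Lam; then the right-hand side minus the left
    increases with s, and at 3s = 2k it would make the form in [quadratic_two]
    positive. *)
Lemma two_members_absurd k K2 W s : 0 < k -> k <= K2 -> k + K2 <= W ->
    (3 * K2 <= 4 * k -> 2 * W <= 9 * k) -> 0 < s -> 3 * s <= 2 * k ->
  let Y := W - k in let Lam := k * (W + 1) - s * W in
  Lam * (K2 * ((W + 1) + s)) <= k * s * (K2 * W - k * Y) + 2 * Lam * Y * s ->
  False.
Proof.
move=> k0 kK KW Wup s0 sk Y Lam star.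
have W0 : 0 < W by lra.
have Lam0 : 0 < Lam.
  rewrite /Lam; have h : 0 <= W * (2 * k - 3 * s) by apply: mulr_ge0; lra.
  have kW : 0 < k * W by apply: mulr_gt0.
  lra.
have Q0 : 0 <= K2 * W - k * Y.
  have h : 0 <= (K2 - k) * W by apply: mulr_ge0; lra.
  rewrite /Y; have k2 : 0 < k * k by apply: mulr_gt0.
  lra.
have sW : s * W <= 2 * Lam.
  rewrite /Lam; have h : 0 <= W * (2 * k - 3 * s) by apply: mulr_ge0; lra.
  lra.
have step : W * (K2 * (W + 1 + s)) <= 2 * k * (K2 * W - k * Y) + 2 * W * Y * s.
  rewrite -(ler_pM2l Lam0).
  have h1 : W * (Lam * (K2 * (W + 1 + s))) <=
      W * (k * s * (K2 * W - k * Y) + 2 * Lam * Y * s) by rewrite ler_pM2l.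
  have h2 : 0 <= (2 * Lam - s * W) * (k * (K2 * W - k * Y)).
    by apply: mulr_ge0; [lra | apply: mulr_ge0; lra].
  lra.
have h1 : 0 <= (2 * k - 3 * s) * (W * (2 * Y - K2)).
  by rewrite /Y; apply: mulr_ge0; [lra | apply: mulr_ge0; lra].
have WK : 0 < W * K2 by apply: mulr_gt0; lra.
have := quadratic_two k0 kK KW Wup.
rewrite /Y in step h1; clear -step h1 WK; lra.
Qed.

(** The same for q >= 3, where the two bounds on s come from
    3s + 6 <= 3q + 2k and 3q < k. *)
Lemma many_members_absurd k K2 W s q : 0 < k -> k <= K2 -> k + K2 <= W ->
    (3 * K2 <= 4 * k -> 2 * W <= 9 * k) -> 0 < s -> 0 < q - 1 -> s < k ->
    3 * s <= 5 * (q - 1) * (k - s) -> 6 * q * s <= 7 * k * (q - 1) ->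
  let Y := W - k in let Lam := k * (W + 1) - s * W in
  Lam * (K2 * ((q - 1) * (W + 1) + s)) <= k * s * (K2 * W - k * Y) + q * Lam * Y * s ->
  False.
Proof.
move=> k0 kK KW Wup s0 q1 sk sc sq Y Lam star.
have W0 : 0 < W by lra.
have ksW : 0 < (k - s) * W by apply: mulr_gt0; lra.
have Lam0 : (k - s) * W < Lam by rewrite /Lam; lra.
have Lam1 : 0 < Lam by lra.
have Q0 : 0 <= K2 * W - k * Y.
  have h : 0 <= (K2 - k) * W by apply: mulr_ge0; lra.
  rewrite /Y; have k2 : 0 < k * k by apply: mulr_gt0.
  lra.
have sW : 3 * (s * W) <= 5 * (q - 1) * Lam.
  have h1 : 0 <= W * (5 * (q - 1) * (k - s) - 3 * s) by apply: mulr_ge0; lra.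
  have h2 : 0 <= (q - 1) * (Lam - (k - s) * W) by apply: mulr_ge0; lra.
  lra.
have step : 3 * (W * (K2 * ((q - 1) * (W + 1) + s))) <=
    5 * (q - 1) * k * (K2 * W - k * Y) + 3 * (q * (W * Y * s)).
  rewrite -(ler_pM2l Lam1).
  have h1 : W * (Lam * (K2 * ((q - 1) * (W + 1) + s))) <=
      W * (k * s * (K2 * W - k * Y) + q * Lam * Y * s) by rewrite ler_pM2l.
  have h2 : 0 <= (5 * (q - 1) * Lam - 3 * (s * W)) * (k * (K2 * W - k * Y)).
    by apply: mulr_ge0; [lra | apply: mulr_ge0; lra].
  lra.
have h1 : 0 <= (7 * k * (q - 1) - 6 * q * s) * (W * Y).
  by rewrite /Y; apply: mulr_ge0; [lra | apply: mulr_ge0; lra].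
have WKs : 0 < W * K2 * s by apply: mulr_gt0 => //; apply: mulr_gt0; lra.
have WK : 0 < W * K2 * (q - 1) by apply: mulr_gt0 => //; apply: mulr_gt0; lra.
have step2 : 0 < (q - 1) * ((7 * k - 6 * K2) * W ^+ 2
    + (10 * k * K2 - 17 * k ^+ 2) * W + 10 * k ^+ 3).
  rewrite /Y in step h1; clear -step h1 WKs WK; lra.
have := quadratic_many k0 kK KW Wup.
by rewrite pmulr_rgt0 // in step2; rewrite leNgt step2.
Qed.

End Quadratics.

(** The counts for a barrier whose q members all send at least 3k - 6 edges
    to S. *)
Lemma barrier_count_bounds k s q t :
  6 <= k -> (3 * k - 6) * q + 2 * t <= k * s -> s + 2 <= q + 2 * t -> 3 * t <= k ->
  2 * t <= s ->
  [/\ 1 < q, 0 < s, 3 * q < k, s < k & 3 * s + 6 <= 3 * q + 2 * k].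
Proof.
move=> k6 cut def tk ts.
have q2 : 1 < q by lia.
have s0 : 0 < s by case: s cut {def ts} => // cut; nia.
have qk : 3 * q < k.
  rewrite ltnNge; apply/negP=> ge.
  have h1 : k * s <= k * (q + 2 * t - 2) by rewrite leq_mul2l; lia.
  have [p kE] : exists p, k = p + 6 by exists (k - 6); lia.
  have [r qE] : exists r, q = r + 2 by exists (q - 2); lia.
  have h2 : (3 * k - 6) * q + 2 * t <= k * (q + 2 * t - 2) by apply: leq_trans cut h1.
  move: h2 ge tk; rewrite kE qE.
  have -> : 3 * (p + 6) - 6 = 3 * p + 12 by lia.
  have -> : r + 2 + 2 * t - 2 = r + 2 * t by lia.
  clear; nia.
by split=> //; lia.
Qed.

Section AverageFlow.
Local Open Scope ring_scope.

(** The last hypothesis is the sum of [vertex_flow] over the members, see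
    [member_flow].  The factor mu is cancelled through mu K2 = k b_1, which turns
    the inequality into the one refuted above. *)
Lemma average_flow_absurd (k b1 mu v s q t K2 K3 : nat) :
    (3 <= mu -> 2 * mu <= k -> mu <= b1 -> mu * K2 = k * b1 -> 1 + k + K2 < v ->
    (3 * mu <= 2 * b1) \/ (v = 1 + k + K2 + K3 /\ mu * K3 <= b1 * K2) ->
    (3 * k - 6) * q + 2 * t <= k * s -> s + 2 <= q + 2 * t -> 3 * t <= k -> 2 * t <= s ->
    (k * v - s * (v - 1)) * (k * b1 * ((q - 1) * v + s)) <=
      k * (b1 * (v - 1) - mu * (v - 1 - k)) * (k * s) +
      q * (k * v - s * (v - 1)) * (mu * s * (v - 1 - k)) -> False)%N.
Proof.
move=> mu3 muk mub muK vlow alt cut def tk ts.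
have k6 : (6 <= k)%N by clear -mu3 muk; lia.
have [q2 s0 qk sk sq] := barrier_count_bounds k6 cut def tk ts.
have [W vE] : exists W, v = W.+1 by exists v.-1; clear -vlow; lia.
have kKW : (k + K2 <= W)%N by clear -vE vlow; lia.
have kK : (k <= K2)%N.
  rewrite -(@leq_pmul2l mu) ?muK; last exact: leq_trans mu3.
  by rewrite mulnC leq_mul2l mub orbT.
have subW : (v - 1 = W)%N by rewrite vE subn1.
rewrite subW -(ler_nat rat) natrD !natrM.
have leY : (k <= W)%N by clear -kKW; lia.
have leQ : (mu * (W - k) <= b1 * W)%N by rewrite leq_mul // leq_subr.
have leL : (s * W <= k * v)%N by rewrite vE leq_mul // ltnW // ltnS.
rewrite !natrB // ?(ltnW q2) // !natrD !natrM (natrB _ leY) natrB ?(ltnW q2) //.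
rewrite vE -addn1 natrD.
have Wup : 3 * K2%:R <= 4 * k%:R :> rat -> 2 * W%:R <= 9 * k%:R :> rat.
  move=> le; case: alt => [alt|[vE' K3le]].
    have : (3 * k <= 2 * K2)%N.
      rewrite -(@leq_pmul2l mu); last exact: leq_trans mu3.
      rewrite (mulnCA mu 2) muK (mulnCA 2).
      by rewrite (mulnCA mu 3) (mulnC mu) (mulnCA 3) leq_mul2l alt orbT.
    rewrite -(ler_nat rat) !natrM => h.
    have k0 : 0 < k%:R :> rat by rewrite ltr0n; apply: leq_trans k6.
    clear -h le k0; lra.
  apply: (@order_le_diam3 _ k%:R K2%:R K3%:R) => //.
  - by rewrite ltr0n; apply: leq_trans k6.
  - by rewrite ler_nat.
  - by rewrite -!natrD; congr (_%:R); move: vE vE'; clear; lia.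
  rewrite expr2 -!natrM ler_nat -(@leq_pmul2l mu); last exact: leq_trans mu3.
  by rewrite mulnCA (mulnA mu) muK -mulnA leq_mul2l K3le orbT.
have b1E : b1%:R = mu%:R * K2%:R / k%:R :> rat.
  by rewrite -natrM muK natrM mulrAC divff ?mul1r // pnatr_eq0 -lt0n (leq_trans _ k6).
rewrite b1E.
have k0 : 0 < k%:R :> rat by rewrite ltr0n (leq_trans _ k6).
have mu0 : 0 < mu%:R :> rat by rewrite ltr0n (leq_trans _ mu3).
have kKr : k%:R <= K2%:R :> rat by rewrite ler_nat.
have kKWr : k%:R + K2%:R <= W%:R :> rat by rewrite -natrD ler_nat.
have s0r : 0 < s%:R :> rat by rewrite ltr0n.
have sqr : 3 * s%:R + 6 <= 3 * q%:R + 2 * k%:R :> rat.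
  by move: sq; rewrite -(ler_nat rat) natrD [leRHS]natrD !natrM.
have qkr : 3 * q%:R + 1 <= k%:R :> rat.
  by move: qk; rewrite -addn1 -(ler_nat rat) natrD natrM.
have skr : s%:R < k%:R :> rat by rewrite ltr_nat.
have q2r : 2 <= q%:R :> rat by rewrite (ler_nat _ 2).
have q23 : q%:R = 2 :> rat \/ 3 <= q%:R :> rat.
  have [->|q3] : q = 2%N \/ (3 <= q)%N by clear -q2; lia.
    by left.
  by right; rewrite (ler_nat _ 3).
clear -k0 mu0 kKr kKWr s0r sqr qkr skr q23 Wup q2r.
move: k0 mu0 kKr kKWr s0r sqr qkr skr q23 Wup q2r.
move: (k%:R : rat) (mu%:R : rat) (K2%:R : rat) (W%:R : rat) (s%:R : rat) (q%:R : rat).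
move=> {}k {}mu {}K2 {}W {}s {}q k0 mu0 kK KW s0 sq qk sk q23 Wup q2 star.
(* b_1 = mu K2 / k makes mu a common factor *)
have {}star : (k * (W + 1) - s * W) * (K2 * ((q - 1) * (W + 1) + s)) <=
    k * s * (K2 * W - k * (W - k)) + q * (k * (W + 1) - s * W) * (W - k) * s.
  rewrite -(ler_pM2l mu0); move: star; congr (_ <= _); field; lra.
case: q23 => [qE|q3].
  have sk2 : 3 * s <= 2 * k by lra.
  apply: (two_members_absurd k0 kK KW Wup s0 sk2); move: star; rewrite qE.
  by congr (_ <= _); ring.
apply: (many_members_absurd k0 kK KW Wup s0 _ sk _ _ star).
- lra.
- have h : 0 <= (q - 3) * (k - 3 * q - 1) by apply: mulr_ge0; lra.
  have h2 : 0 <= (q - 3) * (q - 3) by apply: mulr_ge0; lra.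
  have h3 : 0 <= (q - 1) * (3 * q + 2 * k - 3 * s - 6) by apply: mulr_ge0; lra.
  lra.
- have h : 0 <= (q - 3) * (k - 3 * q - 1) by apply: mulr_ge0; lra.
  have h2 : 0 <= (q - 3) * (q - 3) by apply: mulr_ge0; lra.
  have h3 : 0 <= q * (3 * q + 2 * k - 3 * s - 6) by apply: mulr_ge0; lra.
  lra.
Qed.

End AverageFlow.

(** * Barriers in a distance-regular graph *)

(** Here a of the q members are singletons.  Eliminating q and t, with t at most
    k/3, bounds s - a by k - 3. *)
Lemma few_big_members k s t a q : 6 <= k -> a <= q ->
  k * a + (3 * k - 6) * (q - a) + 2 * t <= k * s -> s + 2 <= q + 2 * t -> 3 * t <= k ->
  s + 3 <= a + k.
Proof.
move=> k6 aq cut def tk; rewrite leqNgt; apply/negP=> lt.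
have [p kE] : exists p, k = p + 6 by exists (k - 6); lia.
have [b qE] : exists b, q = a + b by exists (q - a); lia.
have [r sE] : exists r, s + 2 = a + k + r by exists (s + 2 - a - k); lia.
have [u bE] : exists u, b + 2 * t = k + r + u by exists (b + 2 * t - k - r); lia.
move: cut; rewrite qE addKn kE.
have -> : 3 * (p + 6) - 6 = 3 * p + 12 by lia.
move: sE bE tk; rewrite kE; clear; nia.
Qed.

(** The last hypothesis gives 2ka <= s (a + 1).  With s <= a + k - 3 this is a
    quadratic inequality in a that fails for 1 <= a <= k, while 2a <= s gives
    a <= k - 3. *)
Lemma singletons_absurd k s a mu :
  1 <= a -> 2 * mu <= k -> s + 3 <= a + k -> 2 * a <= s ->
  (k * a) ^ 2 <= s * (k * a + a * (a - 1) * mu) -> False.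
Proof.
move=> a1 muk sak as2 ineq.
have k0 : 0 < k by lia.
have h1 : 2 * (k * a) ^ 2 <= s * (2 * (k * a) + a * (a - 1) * k).
  have h : a * (a - 1) * (2 * mu) <= a * (a - 1) * k by rewrite leq_mul2l muk orbT.
  apply: leq_trans (_ : s * (2 * (k * a) + a * (a - 1) * (2 * mu)) <= _).
    by rewrite (mulnCA (a * (a - 1))) -mulnDr (mulnCA s) leq_mul2l ineq orbT.
  by rewrite leq_mul2l leq_add2l h orbT.
have h2 : 2 * (k * a) <= s * (a + 1).
  have ka : 0 < k * a by rewrite muln_gt0 k0.
  rewrite -(leq_pmul2l ka).
  have -> : k * a * (2 * (k * a)) = 2 * (k * a) ^ 2 by rewrite mulnCA.
  apply: leq_trans h1 _; rewrite (mulnCA (k * a)) leq_mul2l; apply/orP; right.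
  have [p ->] : exists p, a = p + 1 by exists (a - 1); lia.
  by rewrite addnK; nia.
have h3 : s * (a + 1) <= (a + k - 3) * (a + 1) by rewrite leq_mul2r; lia.
have [p aE] : exists p, a = p + 1 by exists (a - 1); lia.
have [r kE] : exists r, k = a + 3 + r by exists (k - a - 3); lia.
move: (leq_trans h2 h3); have -> : a + k - 3 = 2 * a + r by lia.
rewrite kE aE; clear; nia.
Qed.

(** The Cauchy-Schwarz inequality against the constant function. *)
Lemma sum_sq_le (I : finType) (A : {set I}) (F : I -> nat) :
  (\sum_(i in A) F i) ^ 2 <= #|A| * \sum_(i in A) F i ^ 2.
Proof.
set X := \sum_(i in A) F i; set s := #|A|.
have [s0|s_gt0] := posnP s.
  by rewrite /X big1 // => i Ai; move: s0; rewrite /s (cardD1 i) Ai.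
rewrite -(leq_pmul2l s_gt0).
have : 2 * (s * X * X) <= \sum_(i in A) ((s * F i) ^ 2 + X ^ 2).
  rewrite [s * X * X](_ : _ = \sum_(i in A) s * F i * X); last first.
    by rewrite -big_distrl /= -big_distrr.
  by rewrite big_distrr /=; apply: leq_sum => i _; apply: nat_Cauchy.
rewrite big_split /= sum_nat_const -/s.
rewrite (eq_bigr (fun i => s ^ 2 * F i ^ 2)) => [|i _]; last by rewrite expnMn.
rewrite -big_distrr /= -!mulnn mul2n -addnn -!mulnA leq_add2r.
by [].
Qed.

(** For one member of size m with E outgoing edges, n is the least number of
    neighbours in S of one of its vertices.  As n <= s, the flow inequality first
    gives L <= k m for L = k v - s W, a lower bound on m; then L n <= k m n <= k E
    replaces n by the number of edges, a quantity that can be summed over the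
    members. *)
Lemma member_flow k b1 mu W Y s n m v E : 0 < b1 -> n <= s -> mu * Y <= b1 * W ->
  m <= v -> n * m <= E -> k * b1 * (v - m) <= b1 * n * W + mu * (s - n) * Y ->
  (k * v - s * W) * (k * b1 * (v - m)) <=
    k * (b1 * W - mu * Y) * E + (k * v - s * W) * (mu * s * Y).
Proof.
move=> b1_gt0 ns muY mv nmE flow.
set Q := b1 * W - mu * Y; set L := k * v - s * W.
have QE : b1 * W = Q + mu * Y by rewrite /Q subnK.
have flow' : k * b1 * (v - m) <= n * Q + mu * s * Y.
  apply: leq_trans flow _; rewrite (mulnC b1) -mulnA QE mulnDr -addnA leq_add2l.
  by rewrite -{2}(subnKC ns) mulnDr mulnDl (mulnCA n) mulnA.
have Lm : L <= k * m.
  have : k * (v - m) <= s * W.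
    rewrite -(leq_pmul2l b1_gt0) mulnA (mulnC b1 k).
    apply: leq_trans flow' _; rewrite (mulnCA b1) QE mulnDr mulnCA mulnA leq_add2r.
    by rewrite leq_mul2r ns orbT.
  by rewrite mulnBr /L; clear; lia.
apply: leq_trans (leq_mul (leqnn L) flow') _.
have Ln : L * n <= k * E.
  apply: leq_trans (leq_mul Lm (leqnn n)) _.
  by rewrite -mulnA leq_mul2l (mulnC m) nmE orbT.
by rewrite mulnDr leq_add2r mulnA (mulnAC k) leq_mul2r Ln orbT.
Qed.

Section Barrier.
Variables (T : finType) (e : rel T) (k lam mu : nat) (b c : nat -> nat).
Hypothesis G : drg e k lam mu b c.
Hypothesis lam_gt0 : 0 < lam.
Hypothesis mu_ge3 : 2 < mu.
Hypothesis mu_le : 2 * mu <= k.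
Hypothesis evenT : ~~ odd #|T|.
Implicit Types (x y z u w : T) (A : {set T}).

Let e_sym := drg_sym G.
Let e_irr := drg_irr G.
Let e_conn := drg_conn G.
Local Notation N x := [set z | e x z] (only parsing).

Lemma k_ge6 : 6 <= k. Proof. by move: mu_ge3 mu_le; clear; lia. Qed.

Variables (S : {set T}) (P : {set {set T}}) (t : nat).
Hypothesis trivP : trivIset P.
Hypothesis closedP : forall C, C \in P -> odd_closed e (~: S) C.
Hypothesis deficient : #|S| + 2 <= #|P| + 2 * t.
Hypothesis t_small : 3 * t <= k.
Hypothesis t_le : 2 * t <= #|S|.
Hypothesis cutS : edge_cut e S + 2 * t <= k * #|S|.

Lemma member_out C w u : C \in P -> w \in C -> e w u -> u \notin C -> u \in S.
Proof.
move=> PC Cw ewu; apply: contraR => nSu.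
have /and3P[_ _ /closed_inP clC] := closedP PC.
by apply: clC Cw _ ewu; rewrite inE.
Qed.

Lemma member_disj C : C \in P -> [disjoint C & S].
Proof.
by case/closedP/and3P=> CS _ _; rewrite disjoints_subset.
Qed.

Lemma cut_members : \sum_(C in P) edge_cut e C <= edge_cut e S.
Proof.
apply: (@leq_trans (\sum_(C in P) \sum_(w in C) #|N w :&: S|)).
  apply: leq_sum => C PC; apply: leq_sum => w Cw; apply: subset_leq_card.
  apply/subsetP=> u; rewrite !inE => /andP[nCu ewu].
  by rewrite ewu (member_out PC Cw ewu nCu).
have <- : \sum_(w in cover P) #|N w :&: S| = \sum_(C in P) \sum_(w in C) #|N w :&: S|.
  exact: big_trivIset.
rewrite -(edge_cutC G) /edge_cut.
rewrite [leqRHS](bigID (mem (cover P))) /= -[leqLHS]addn0 leq_add //.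
rewrite [leqLHS](eq_bigl (fun w => (w \in ~: S) && (w \in cover P))).
  by apply: leq_sum => w _; rewrite setDE setCK.
move=> w /=; rewrite andbC; apply/idP/andP=> [Pw|[]//]; split=> //.
case/bigcupP: Pw => C /closedP/and3P[CS _ _]; exact: (subsetP CS).
Qed.

Let P1 := [set C in P | #|C| == 1].
Let I := cover P1.

Lemma singleP w : w \in I -> N w \subset S /\ w \notin S.
Proof.
case/bigcupP=> C; rewrite inE => /andP[PC /cards1P[w' CE]].
rewrite CE inE => /eqP ww'; rewrite -ww' in CE.
have Cw : w \in C by rewrite CE inE.
split; last by rewrite (disjointFr (member_disj PC) Cw).
apply/subsetP=> u; rewrite inE => ewu; apply: (member_out PC Cw ewu).
by rewrite CE inE; apply: contraTneq ewu => ->; rewrite e_irr.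
Qed.

Lemma card_singles : #|I| = #|P1|.
Proof.
have triv1 : trivIset P1.
  by apply: trivIsetS trivP; apply/subsetP=> C; rewrite inE => /andP[].
rewrite -(eqP triv1) -sum1_card; apply: eq_bigr => C; rewrite inE.
by case/andP=> _ /eqP.
Qed.

Lemma big_member C : C \in P -> C \notin P1 -> 3 <= #|C|.
Proof.
move=> PC; rewrite inE PC /=; have /and3P[_ + _] := closedP PC.
by case: #|C| => [|[|[|]]].
Qed.

Lemma card_P_gt1 : 1 < #|P|.
Proof. by move: deficient t_le; clear; lia. Qed.

(** S contains the neighbourhood of every singleton; without singletons there is
    another large member. *)
Lemma card_co_member C : C \in P -> C \notin P1 -> 3 <= #|~: C|.
Proof.
move=> PC nC1; have [I0|[w Iw]] := set_0Vmem I; last first.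
  have [NS _] := singleP Iw.
  apply: (@leq_trans #|N w|); first by rewrite (drg_val G) (leq_trans _ k_ge6).
  apply: subset_leq_card; apply: subset_trans NS _.
  by rewrite -disjoints_subset disjoint_sym member_disj.
have [C' PC' neqC] : exists2 C', C' \in P & C' != C.
  have := card_P_gt1; rewrite (cardsD1 C) PC ltnS => /card_gt0P[C'].
  by rewrite !inE => /andP[neq PC']; exists C'.
have P10 : P1 = set0 by apply/eqP; rewrite -cards_eq0 -card_singles I0 cards0.
apply: leq_trans (big_member PC' _) _; first by rewrite P10 inE.
apply: subset_leq_card; rewrite -disjoints_subset.
by move/trivIsetP: trivP; apply.
Qed.

Lemma cut_count : k * #|P1| + (3 * k - 6) * (#|P| - #|P1|) + 2 * t <= k * #|S|.
Proof.
apply: leq_trans cutS; rewrite leq_add2r; apply: leq_trans cut_members.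
rewrite (bigID (mem P1)) /= leq_add //.
  rewrite mulnC -sum_nat_const [leqRHS](eq_bigl (mem P1)) => [|C]; last first.
    by rewrite /= !inE; case: (C \in P).
  apply: leq_sum => C; rewrite inE => /andP[PC /cards1P[w ->]].
  rewrite /edge_cut big_set1 -(drg_val G w); apply: subset_leq_card.
  apply/subsetP=> u; rewrite !inE => ewu; rewrite ewu andbT.
  by apply: contraTneq ewu => ->; rewrite e_irr.
have -> : #|P| - #|P1| = #|P :\: P1|.
  by rewrite cardsDS //; apply/subsetP=> C; rewrite inE => /andP[].
rewrite mulnC -sum_nat_const [leqRHS](eq_bigl (mem (P :\: P1))) => [|C]; last first.
  by rewrite /= in_setD andbC.
apply: leq_sum => C; rewrite inE => /andP[nC1 PC].
apply: (edge_cut_ge G) => //; first exact: big_member.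
exact: card_co_member.
Qed.

Lemma card_P1_le : #|P1| <= #|P|.
Proof. by apply: subset_leq_card; apply/subsetP=> C; rewrite inE => /andP[]. Qed.

Lemma few_nonsingles : #|S| + 3 <= #|P1| + k.
Proof. exact: few_big_members k_ge6 card_P1_le cut_count deficient t_small. Qed.

Let deg1 u := #|N u :&: I|.

Lemma sum_deg1 : \sum_(u in S) deg1 u = k * #|P1|.
Proof.
have -> : \sum_(u in S) deg1 u = \sum_(u in S) \sum_(w in I) e u w.
  apply: eq_bigr => u _; rewrite -card_set_sum; apply: eq_card => w.
  by rewrite !inE andbC.
rewrite exchange_big /= -card_singles mulnC -sum_nat_const.
apply: eq_bigr => w Iw; have [NS _] := singleP Iw.
under eq_bigr do rewrite e_sym.
rewrite -card_set_sum -(drg_val G w); apply: eq_card => u; rewrite !inE.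
by apply/andP/idP=> [[]|ewu] //; split=> //; apply: (subsetP NS); rewrite inE.
Qed.

(** In the lam-regular local graph at u the singletons are independent, so all
    their lam neighbours lie among the remaining vertices; counting these edges
    from both ends, the singletons are at most half of the k vertices. *)
Lemma deg1_le u : 2 * deg1 u <= k.
Proof.
set J := N u :&: I.
have cD : #|N u :\: J| = k - deg1 u.
  by rewrite cardsDS ?subsetIl // (drg_val G).
have leJ : deg1 u <= k by rewrite -(drg_val G u) subset_leq_card ?subsetIl.
suff : deg1 u * lam <= (k - deg1 u) * lam.
  by rewrite leq_pmul2r // => h; move: h leJ; clear; lia.
rewrite -cD -!sum_nat_const /deg1 -/J.
apply: (@leq_trans (\sum_(w in J) \sum_(z in N u :\: J) e w z)).
  apply: leq_sum => w; rewrite inE => /andP[]; rewrite inE => euw Iw.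
  rewrite -card_set_sum -(drg_lam G euw); apply: subset_leq_card.
  apply/subsetP=> z; rewrite !inE => /andP[euz ewz]; rewrite euz ewz !andbT /=.
  have [NS _] := singleP Iw; apply/negP=> /singleP[_ /negP]; apply.
  by apply: (subsetP NS); rewrite inE.
rewrite exchange_big /=; apply: leq_sum => z; rewrite !inE => /andP[_ euz].
under eq_bigr do rewrite e_sym.
rewrite -card_set_sum -(drg_lam G euz); apply: subset_leq_card.
by apply/subsetP=> w; rewrite !inE => /andP[/andP[-> _] ->].
Qed.

(** The sum counts pairs of singletons with a common neighbour in S.  Distinct
    singletons are not adjacent, so they have mu common neighbours or none. *)
Lemma sum_deg1_sq : \sum_(u in S) deg1 u ^ 2 <=
  k * #|P1| + #|P1| * (#|P1| - 1) * mu.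
Proof.
have -> : \sum_(u in S) deg1 u ^ 2 =
    \sum_(w in I) \sum_(w' in I) #|common_neighbors e w w' :&: S|.
  transitivity (\sum_(u in S) \sum_(w in I) \sum_(w' in I) (e u w * e u w')).
    apply: eq_bigr => u _; rewrite -mulnn.
    have dE : deg1 u = \sum_(w in I) e u w.
      by rewrite -card_set_sum; apply: eq_card => w; rewrite !inE andbC.
    rewrite {1}dE big_distrl /=; apply: eq_bigr => w _.
    by rewrite dE big_distrr.
  rewrite exchange_big /=; apply: eq_bigr => w _.
  rewrite exchange_big /=; apply: eq_bigr => w' _.
  rewrite (eq_bigr (fun u => nat_of_bool (e w u && e w' u))) => [|u _].
    by rewrite -card_set_sum; apply: eq_card => u; rewrite !inE andbC.
  by rewrite -mulnb !(e_sym u).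
rewrite -card_singles.
have -> : k * #|I| + #|I| * (#|I| - 1) * mu = \sum_(w in I) (k + (#|I| - 1) * mu).
  by rewrite sum_nat_const mulnDr mulnC mulnA.
apply: leq_sum => w Iw; rewrite (bigD1 w Iw) /= leq_add //.
  rewrite -(drg_val G w); apply: subset_leq_card; apply/subsetP=> u.
  by rewrite !inE => /andP[/andP[]].
have -> : #|I| - 1 = #|I :\ w| by rewrite (cardsD1 w I) Iw addKn.
rewrite -sum_nat_const [leqLHS](eq_bigl (fun w' => w' \in I :\ w)) => [|w']; last first.
  by rewrite /= in_setD1 andbC.
apply: leq_sum => w'; rewrite in_setD1 => /andP[neq Iw'].
apply: (@leq_trans #|common_neighbors e w w'|).
  by rewrite subset_leq_card ?subsetIl.
have [->|[u]] := set_0Vmem (common_neighbors e w w'); first by rewrite cards0.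
rewrite inE => /andP[ewu ew'u]; rewrite (drg_mu G) //.
apply: (@dist_eq2 _ _ _ _ _ _ _ G _ _ u) => //; rewrite 1?eq_sym 1?(e_sym u) //.
apply/negP=> eww'; have [NS _] := singleP Iw; have [_ /negP] := singleP Iw'; apply.
by apply: (subsetP NS); rewrite inE.
Qed.

Lemma no_singles : P1 = set0.
Proof.
apply/eqP; rewrite -cards_eq0; apply/negPn/negP; rewrite -lt0n => a_gt0.
have twice : 2 * #|P1| <= #|S|.
  have : k * (2 * #|P1|) <= k * #|S|.
    rewrite mulnCA -sum_deg1 big_distrr /= mulnC -sum_nat_const.
    by apply: leq_sum => u _; apply: deg1_le.
  by rewrite leq_pmul2l // (leq_trans _ k_ge6).
apply: (singletons_absurd a_gt0 mu_le few_nonsingles twice).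
rewrite -sum_deg1; apply: leq_trans (sum_sq_le _ _) _.
by rewrite leq_mul2l sum_deg1 sum_deg1_sq orbT.
Qed.

(** Without singletons every member has at least three vertices, and the flows
    from a vertex with fewest neighbours in S, one for each member, are added. *)
Lemma no_deficient_barrier : False.
Proof.
have big C : C \in P -> 3 <= #|C|.
  by move=> PC; apply: big_member; rewrite // no_singles inE.
have cut : (3 * k - 6) * #|P| + 2 * t <= k * #|S|.
  by move: cut_count; rewrite no_singles cards0 muln0 subn0.
have [x0 _] := drg_point G.
have [muK vlow alt] := diameter_regimes G x0 (ltnW mu_ge3).
have k0 : 0 < k by apply: leq_trans k_ge6.
have b1_gt0 : 0 < b 1 by apply: leq_trans (mu_le_b1 G); apply: leq_trans mu_ge3.
set v := #|T| in vlow alt *.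
pose L := k * v - #|S| * (v - 1).
pose Q := b 1 * (v - 1) - mu * (v - 1 - k).
have member C : C \in P ->
    L * (k * b 1 * #|~: C|) <= k * Q * edge_cut e C + L * (mu * #|S| * (v - 1 - k)).
  move=> PC; have dCS := member_disj PC.
  have [y0 Cy0] : exists x, x \in C.
    by apply/set0Pn; rewrite -card_gt0 (leq_trans _ (big C PC)).
  case: (arg_minnP (fun x => #|N x :&: S|) Cy0) => x Cx minx.
  have cC : #|~: C| = v - #|C| by rewrite /v -(cardsC C) addKn.
  have flow := vertex_flow G k0 Cx dCS (fun w u Cw nCu ewu => member_out PC Cw ewu nCu).
  rewrite cC; apply: (member_flow b1_gt0 _ _ _ _ (n := #|N x :&: S|)).
  - by rewrite subset_leq_card ?subsetIr.
  - by rewrite leq_mul ?(mu_le_b1 G) ?leq_subr.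
  - exact: max_card.
  - rewrite mulnC -sum_nat_const; apply: leq_sum => w Cw.
    apply: leq_trans (minx w Cw) _; apply: subset_leq_card.
    apply/subsetP=> u; rewrite !inE => /andP[-> Su].
    by rewrite (disjointFl dCS Su).
  - by rewrite -cC.
(* the members lie outside S, so their complements are large on average *)
have sizes : (#|P| - 1) * v + #|S| <= \sum_(C in P) #|~: C|.
  have tot : \sum_(C in P) #|~: C| + #|cover P| = #|P| * v.
    rewrite -(eqP trivP) -big_split /= -sum_nat_const.
    by apply: eq_bigr => C _; rewrite addnC cardsC.
  have covS : #|cover P| + #|S| <= v.
    rewrite /v -(cardsC S) addnC leq_add2l subset_leq_card //.
    by apply/bigcupsP=> C /closedP/and3P[].
  have := card_P_gt1; move: tot covS; case: #|P| => // q.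
  by rewrite subn1 mulSn /=; clear; lia.
apply: (average_flow_absurd mu_ge3 mu_le (mu_le_b1 G) muK vlow _ cut deficient
         t_small t_le).
  case: alt => [|[vE cK bb cc _]]; [by left | right; split; first exact: vE].
  apply: (@leq_trans (c 3 * #|sphere e x0 3|)); first by rewrite leq_mul2r cc orbT.
  by rewrite cK leq_mul2r bb orbT.
rewrite -/L -/Q.
apply: (@leq_trans (\sum_(C in P) L * (k * b 1 * #|~: C|))).
  by rewrite -big_distrr /= -big_distrr /= !leq_mul2l sizes !orbT.
apply: leq_trans (leq_sum _ member) _.
rewrite big_split /= sum_nat_const mulnA leq_add2r -big_distrr /= leq_mul2l.
apply/orP; right; apply: leq_trans cut_members _.
by apply: leq_trans cutS; rewrite leq_addr.
Qed.

End Barrier.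

(** * Extending matchings *)

Section Extension.
Variables (T : finType) (e : rel T) (k lam mu : nat) (b c : nat -> nat).
Hypothesis G : drg e k lam mu b c.
Hypothesis lam_gt0 : 0 < lam.
Hypothesis mu_ge3 : 2 < mu.
Hypothesis mu_le : 2 * mu <= k.
Hypothesis evenT : ~~ odd #|T|.

Lemma matching_edge (M : {set {set T}}) X u : matching e M -> X \in M -> u \in X ->
  #|X| = 2 /\ exists2 w, w \in X & e u w.
Proof.
case/andP=> sM _ /(subsetP sM) /imsetP[[y z]]; rewrite inE /= => eyz -> Xu.
have neq : y != z by apply: contraTneq eyz => ->; rewrite (drg_irr G).
split; first by rewrite cards2 neq.
move: Xu; rewrite !inE => /orP[/eqP->|/eqP->].
  by exists z; rewrite // !inE eqxx orbT.
by exists y; rewrite ?inE ?eqxx // (drg_sym G).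
Qed.

Lemma card_cover_matching (M : {set {set T}}) : matching e M ->
  #|cover M| = 2 * #|M|.
Proof.
move=> matM; have /andP[sM tM] := matM; rewrite -(eqP tM) mulnC -sum_nat_const.
apply: eq_bigr => X MX; have [] // : #|X| = 2 /\ True.
have [[y z] _ XE] := imsetP (subsetP sM X MX).
have Xy : y \in X by rewrite XE !inE eqxx.
by have [] := matching_edge matM MX Xy.
Qed.

(** A perfect matching of the vertices missed by M completes M; a Tutte barrier
    S there, enlarged by the vertices of M, is excluded by
    [no_deficient_barrier]. *)
Theorem matching_extends (M : {set {set T}}) : matching e M -> 3 * #|M| <= k ->
  exists2 M', perfect_matching e M' & M \subset M'.
Proof.
move=> matM leM; set U := ~: cover M.
have cM := card_cover_matching matM.
have [[M' matM' covM']|[S [P [barP ltSP]]]] := tutte (drg_sym G) U.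
  have [|matU covU] := matchingU matM matM'.
    by rewrite covM' disjoint_sym disjoints_subset.
  exists (M :|: M'); last exact: subsetUl.
  by rewrite /perfect_matching matU covU covM' setUCr eqxx.
have evenU : ~~ odd #|U|.
  have := cardsC (cover M); rewrite cM -/U => cU.
  by move: evenT; rewrite -cU oddD mul2n odd_double.
have {P barP ltSP}[P barP ltSP] := barrier_parity (drg_sym G) evenU barP ltSP.
have [SU tP ocP] := barrierP _ _ _ _ barP.
have dS : [disjoint S & cover M] by rewrite disjoints_subset.
have WE : ~: (S :|: cover M) = U :\: S by rewrite setCU setIC setDE.
have cS : #|S :|: cover M| = #|S| + 2 * #|M|.
  by rewrite cardsU (disjoint_setI0 dS) cards0 subn0 cM.
case: (no_deficient_barrier G lam_gt0 mu_ge3 mu_le evenT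
         (S := S :|: cover M) (P := P) (t := #|M|)) => //.
- by move=> C /ocP; rewrite WE.
- by rewrite cS addnAC leq_add2r addn2.
- by rewrite cS leq_addl.
have covE : 2 * #|M| = \sum_(u in S :|: cover M) (u \in cover M).
  rewrite -cM -card_set_sum; apply: eq_card => u; rewrite !inE.
  by case: (u \in cover M); rewrite ?orbT ?andbF.
rewrite covE /edge_cut -big_split /= mulnC -sum_nat_const; apply: leq_sum => u Su.
have [/bigcupP[X MX Xu]|_] := boolP (u \in cover M); last first.
  by rewrite addn0 -(drg_val G u) subset_leq_card ?subsetDl.
(* u has a neighbour in the enlarged barrier set, hence at most k - 1 outside *)
have [_ [w Xw euw]] := matching_edge matM MX Xu.
rewrite addn1 -(drg_val G u); apply: proper_card; rewrite properE subsetDl.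
apply/subsetPn; exists w; first by rewrite inE.
rewrite !inE; have -> : w \in cover M by apply/bigcupP; exists X.
by rewrite orbT.
Qed.

End Extension.

Local Open Scope ring_scope.

(** The quotient is less than (k - 2)/3, because (k - 3)(k - 1) < (k - 2)^2. *)
Lemma ceil_bound (k : nat) : (6 <= k)%N ->
  (3 * `|Num.ceil ((k%:R - 3) * (k%:R - 1) / (3 * k%:R - 6) : rat)| <= k)%N.
Proof.
move=> k6; set x := (_ / _ : rat).
have k6r : 6 <= k%:R :> rat by rewrite (ler_nat _ 6).
have den : 0 < 3 * k%:R - 6 :> rat by lra.
have x_ge0 : 0 <= x by apply: divr_ge0; [apply: mulr_ge0; lra | lra].
have x_lt : x < (k%:R - 2) / 3.
  by rewrite ltr_pdivrMr //; nra.
have c_ge0 : 0 <= Num.ceil x by rewrite ceil_ge0; lra.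
have := ceilB1_lt x; rewrite -[Num.ceil x in X in X -> _]gez0_abs // rmorphB /=.
set n := `|_|%N; rewrite -[n%:~R]/(n%:R : rat) => n_lt.
have : (3 * n)%:R < (k.+1)%:R :> rat by rewrite natrM -addn1 natrD; lra.
by rewrite ltr_nat ltnS.
Qed.

Theorem theorem3p15 (T : finType) (e : rel T) (k lambda mu : nat)
    (e_sym : symmetric e) (e_irr : irreflexive e)
    (even_order : ~~ odd #|T|)
    (e_drg : distance_regular e)
    (diam_ge3 : (3 <= diameter e)%N)
    (valency_k : regular_of_valency e k)
    (def_lambda : forall x y : T, e x y -> #|common_neighbors e x y| = lambda)
    (def_mu : forall x y : T,
        gdist e x y = 2%N -> #|common_neighbors e x y| = mu)
    (lambda_ge1 : (1 <= lambda)%N)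
    (mu_ge3 : (3 <= mu)%N)
    (mu_le : mu%:R <= k%:R / 2 :> rat) :
  extendable e
    `|Num.ceil ((k%:R - 3) * (k%:R - 1) / (3 * k%:R - 6) : rat)|%N.
Proof.
case: e_drg => e_conn [b [c bc]].
have G : drg e k lambda mu b c by [].
have mu_le_nat : (2 * mu <= k)%N.
  by rewrite -(ler_nat rat) natrM mulrC -ler_pdivlMr.
have k6 : (6 <= k)%N by apply: leq_trans mu_le_nat; rewrite (leq_mul2l 2 3).
have t_le := ceil_bound k6; set t := `|_|%N in t_le *.
have ext := matching_extends G lambda_ge1 mu_ge3 mu_le_nat even_order.
split=> //.
- have [M0 cov0] := set0_matching e.
  by have [|M perfM _] := ext set0 M0; [rewrite cards0 muln0 | exists M].
- have [x _] := drg_point G.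
  have [_ vlow _] := diameter_regimes G x (ltnW mu_ge3).
  have {vlow}kT : (k + 2 <= #|T|)%N by move: vlow; clear; lia.
  by rewrite geq_half_double -addnn; move: kT t_le k6; clear; lia.
by move=> M matM cM; apply: ext; rewrite ?cM.
Qed.
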